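(* Let $a>1$, $C_j(n,a)=\binom{n}{j}\left(\frac{1+a}{2}\right)^{n-j}\left(\frac{1-a}{2}\right)^j$ and $b_j=-\frac{i}{\sqrt2}(1-\frac{2j}{n})$. Then for every $g\in\mathtt{F}(\mathbb{C})$ there exists a unique $f\in\mathtt{F}(\mathbb{C})$ such that for every $z\in\mathbb{C}$, $$g(z)=\lim_{n\to\infty}\sum_{j=0}^nC_j(n,a)\mathcal{W}_{b_j}[f](z).$$
   Context: $\mathtt{F}(\mathbb{C})$ is the Fock space of entire functions $f$ with $\frac1\pi\int_{\mathbb{C}}|f(z)|^2e^{-|z|^2}d\lambda(z)<\infty$. For $c\in\mathbb{C}$ the Weyl operator is $\mathcal{W}_cf(z)=f(z-c)e^{z\bar c-|c|^2/2}$. *)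

(* Defs.v *)
From mathcomp Require Import all_boot all_algebra.
From mathcomp Require Import complex.
From mathcomp Require Import all_classical all_reals all_analysis.
Import GRing.Theory Num.Theory ComplexField.
Import numFieldTopology.Exports numFieldNormedType.Exports.
Set Implicit Arguments. Unset Strict Implicit. Unset Printing Implicit Defensive.
Local Open Scope ring_scope.
Local Open Scope classical_set_scope.

(* The complex numbers over a real type R, viewed as a numFieldType so that
   MathComp-Analysis' topology / normed-module structure (over itself) applies. *)
Definition C (R : realType) : numFieldType := R[i].

Section Fock.
Variable R : realType.

Definition RtoC (r : R) : C R := Complex r 0.

Definition cexp (w : C R) : C R :=
  RtoC (expR (complex.Re w)) * (Complex (cos (complex.Im w)) (sin (complex.Im w)) : C R).

(* entire = complex differentiable at every point (derivative over the field C) *)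
Definition entire (f : C R -> C R) : Prop := forall z : C R, derivable f z 1.

Definition fock_norm2 (f : C R -> C R) : \bar R :=
  (\int[(@lebesgue_measure R \x @lebesgue_measure R)%E]_p
     ((pi^-1 * ((complex.Re (f (Complex p.1 p.2)))^+2 + (complex.Im (f (Complex p.1 p.2)))^+2)
        * expR (- (p.1 ^+ 2 + p.2 ^+ 2)))%:E))%E.

Definition fock (f : C R -> C R) : Prop := entire f /\ (fock_norm2 f < +oo)%E.

Definition weyl (c : C R) (f : C R -> C R) (z : C R) : C R :=
  f (z - c) * cexp (z * c^* - RtoC ((complex.Re c ^+ 2 + complex.Im c ^+ 2) / 2)).

Definition Cj (n j : nat) (a : R) : C R :=
  RtoC ('C(n, j)%:R * ((1 + a) / 2) ^+ (n - j) * ((1 - a) / 2) ^+ j).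

Definition bj (n j : nat) : C R :=
  - ('i / RtoC (Num.sqrt 2)) * RtoC (1 - (2 * j%:R) / n%:R).

Definition weyl_limit_repr (a : R) (f g : C R -> C R) : Prop :=
  forall z : C R,
    (fun n : nat => \sum_(j < n.+1) Cj n j a * weyl (bj n j) f z) @ \oo --> g z.

End Fock.

(* Main.v *)
(* The nodes satisfy [bj n j = - (i / sqrt 2) t_j] with [t_j = 1 - 2 j / n], and
   [t |-> weyl (- (i / sqrt 2) t) f z] extends from real [t] to an entire function
   [F] of [t].  The sum is thus the [n]-th Bernstein polynomial of [F] on [-1, 1],
   evaluated outside that interval, at [a].  For entire [F] it converges to [F a],
   so the limit operator is the Weyl operator [weyl (- i a / sqrt 2)], which is an
   isometric bijection of the Fock space.

   Convergence for entire [F]: the [n]-th Bernstein polynomial of [t ^ k] at [a]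
   differs from [a ^ k] by at most [a ^ k * k ^ 2 / n], which is harmless once
   [F] is approximated by polynomials whose coefficients are [O((2 a) ^ - k)].
   These are the interpolation polynomials of [F] at the [2 ^ n]-th roots of unity
   scaled to radius [2 a].  Their convergence to [F] is Cauchy's formula, with
   Riemann sums in place of integrals: Goursat's bisection argument shows that the
   Riemann sums of [u |-> h (exp u)] along a parallelogram tend to [0], so means of
   [h] over roots of unity do not depend, in the limit, on the radius. *)
Require Import Defs.
From mathcomp Require Import all_boot all_order all_algebra.
From mathcomp Require Import complex.
From mathcomp Require Import all_classical all_reals all_analysis.
From mathcomp Require Import measurable_realfun.
From mathcomp Require Import ring lra zify.
Import Order.TTheory GRing.Theory Num.Theory ComplexField.
Import numFieldTopology.Exports numFieldNormedType.Exports.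
Set Implicit Arguments. Unset Strict Implicit. Unset Printing Implicit Defensive.
Local Open Scope ring_scope.
Local Open Scope classical_set_scope.

(** * The complex modulus as a real number, and epsilon-delta forms of limits *)

Section ComplexModulus.
Variable R : realType.
Local Notation C := (C R).
Implicit Types (x y : R) (z w : C).

(** The norm on [C R] takes values in [C R] itself; its real part moves estimates into the totally
    ordered field [R]. *)
Definition cabs z : R := complex.Re `|z|.

Lemma normCE z : `|z| = RtoC (cabs z).
Proof. by case: z. Qed.

Lemma cabsE z : cabs z = Num.sqrt (complex.Re z ^+ 2 + complex.Im z ^+ 2).
Proof. by case: z. Qed.

Lemma sqr_cabs z : cabs z ^+ 2 = complex.Re z ^+ 2 + complex.Im z ^+ 2.
Proof. by rewrite cabsE sqr_sqrtr// addr_ge0 ?sqr_ge0. Qed.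

Lemma ler_RtoC x y : (RtoC x <= RtoC y) = (x <= y).
Proof. exact: lecR. Qed.

Lemma ltr_RtoC x y : (RtoC x < RtoC y) = (x < y).
Proof. exact: ltcR. Qed.

Lemma RtoCD x y : RtoC (x + y) = RtoC x + RtoC y.
Proof. exact: (rmorphD (real_complex R)). Qed.
Lemma RtoCB x y : RtoC (x - y) = RtoC x - RtoC y.
Proof. exact: (rmorphB (real_complex R)). Qed.
Lemma RtoCM x y : RtoC (x * y) = RtoC x * RtoC y.
Proof. exact: (rmorphM (real_complex R)). Qed.
Lemma RtoCV x : RtoC x^-1 = (RtoC x)^-1.
Proof. exact: (fmorphV (real_complex R)). Qed.
Lemma RtoCX x n : RtoC (x ^+ n) = RtoC x ^+ n.
Proof. exact: (rmorphXn (real_complex R)). Qed.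
Lemma RtoC_nat n : RtoC (n%:R : R) = n%:R.
Proof. exact: (rmorph_nat (real_complex R)). Qed.
Lemma RtoC_sum I (r : seq I) (P : pred I) (f : I -> R) :
  RtoC (\sum_(i <- r | P i) f i) = \sum_(i <- r | P i) RtoC (f i).
Proof. exact: (rmorph_sum (real_complex R)). Qed.
Lemma RtoC0 : RtoC (0 : R) = 0. Proof. by []. Qed.
Lemma RtoC1 : RtoC (1 : R) = 1. Proof. by []. Qed.
Lemma RtoC_inj : injective (@RtoC R). Proof. by move=> x y []. Qed.

Lemma cabs_ge0 z : 0 <= cabs z.
Proof. by rewrite cabsE sqrtr_ge0. Qed.

Lemma cabsM z w : cabs (z * w) = cabs z * cabs w.
Proof. by apply: RtoC_inj; rewrite RtoCM -!normCE normrM. Qed.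

Lemma cabsX z n : cabs (z ^+ n) = cabs z ^+ n.
Proof. by apply: RtoC_inj; rewrite RtoCX -!normCE normrX. Qed.

Lemma cabsV z : cabs z^-1 = (cabs z)^-1.
Proof. by apply: RtoC_inj; rewrite RtoCV -!normCE normfV. Qed.

Lemma cabsN z : cabs (- z) = cabs z.
Proof. by rewrite /cabs normrN. Qed.

Lemma cabsC z w : cabs (z - w) = cabs (w - z).
Proof. by rewrite -cabsN opprB. Qed.

Lemma cabsD z w : cabs (z + w) <= cabs z + cabs w.
Proof. by rewrite -ler_RtoC RtoCD -!normCE ler_normD. Qed.

Lemma cabsB z w : cabs (z - w) <= cabs z + cabs w.
Proof. by rewrite -(cabsN w) cabsD. Qed.

Lemma cabs0 : cabs 0 = 0. Proof. by rewrite /cabs normr0. Qed.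
Lemma cabs1 : cabs 1 = 1. Proof. by rewrite /cabs normr1. Qed.

Lemma cabs_RtoC x : cabs (RtoC x) = `|x|.
Proof. by rewrite cabsE/= expr0n/= addr0 sqrtr_sqr. Qed.

Lemma cabs_nat n : cabs n%:R = n%:R.
Proof. by rewrite -RtoC_nat cabs_RtoC normr_nat. Qed.

Lemma cabs_eq0 z : (cabs z == 0) = (z == 0).
Proof. by rewrite -(inj_eq RtoC_inj) -normCE normr_eq0. Qed.

Lemma cabs_gt0 z : (0 < cabs z) = (z != 0).
Proof. by rewrite lt_neqAle eq_sym cabs_eq0 cabs_ge0 andbT. Qed.

Lemma cabs_sum I (r : seq I) (P : pred I) (f : I -> C) :
  cabs (\sum_(i <- r | P i) f i) <= \sum_(i <- r | P i) cabs (f i).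
Proof.
elim/big_rec2: _ => [|i y z Pi H]; first by rewrite cabs0.
by apply: le_trans (cabsD _ _) _; rewrite lerD2l.
Qed.

Lemma cabs_Re z : `|complex.Re z| <= cabs z.
Proof. by rewrite -sqrtr_sqr cabsE ler_wsqrtr// lerDl sqr_ge0. Qed.

Lemma cabs_Im z : `|complex.Im z| <= cabs z.
Proof. by rewrite -sqrtr_sqr cabsE ler_wsqrtr// lerDr sqr_ge0. Qed.

Lemma cabs_le_ReIm z : cabs z <= `|complex.Re z| + `|complex.Im z|.
Proof.
rewrite -(@ler_pXn2r _ 2)// ?nnegrE ?cabs_ge0 ?addr_ge0//.
by rewrite sqr_cabs sqrrD !real_normK ?num_real// addrAC lerDl mulrn_wge0// mulr_ge0.
Qed.

(** In the partial order of [R[i]] a positive element has zero imaginary part. Complex-valued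
    tolerances therefore reduce to real ones. *)
Lemma posC_real (e : C) : 0 < e -> exists2 x : R, 0 < x & e = RtoC x.
Proof.
case: e => x y /[dup]; rewrite {1}ltcE/= => /andP[/eqP-> x0] _.
by exists x.
Qed.

Lemma cvg_cabsP (u : nat -> C) (l : C) :
  u @ \oo --> l <->
  (forall e : R, 0 < e -> exists N, forall n, (N <= n)%N -> cabs (l - u n) < e).
Proof.
split.
  move=> /cvgrPdist_lt ul e e0.
  have [|N _ NH] := ul (RtoC e); first by rewrite ltr_RtoC.
  by exists N => n /NH /=; rewrite normCE ltr_RtoC.
move=> H; apply/cvgrPdist_lt => e /posC_real[x x0 ->].
have [N NH] := H _ x0; exists N => // n /NH.
by rewrite /= normCE ltr_RtoC.
Qed.

Lemma continuous_cabsP (f : C -> C) z :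
  {for z, continuous f} <->
  (forall e : R, 0 < e -> exists2 d : R, 0 < d &
     forall w, cabs (w - z) < d -> cabs (f w - f z) < e).
Proof.
split.
  move=> /cvgrPdist_lt fz e e0.
  have /fz : 0 < RtoC e by rewrite ltr_RtoC.
  move=> /nbhs_normP[d /= /posC_real[y y0 ->] dH].
  exists y => // w wz; have /= := dH w.
  rewrite /ball_ /= !normCE !ltr_RtoC (cabsC z) (cabsC (f z)); exact.
move=> H; apply/(@cvgrPdist_lt _ _ _ (nbhs z) (nbhs_filter (z : C)) f) => e /posC_real[x x0 ->].
have [d d0 dH] := H _ x0.
apply/nbhs_normP; exists (RtoC d); first by rewrite /= ltr_RtoC.
move=> w /=; rewrite !normCE !ltr_RtoC (cabsC z) (cabsC (f z)); exact: dH.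
Qed.

(** The division-free form also covers [w = z], so sample points may hit [z] without a case
    distinction. *)
Lemma derivable_cabsP (f : C -> C) z :
  derivable f z 1 <->
  exists l : C, forall e : R, 0 < e -> exists2 d : R, 0 < d &
     forall w, cabs (w - z) < d ->
       cabs (f w - f z - l * (w - z)) <= e * cabs (w - z).
Proof.
split.
  move=> /cvg_ex[l fl]; have fz := proj1 (cvgrPdist_lt _ _) fl; exists l => e e0.
  have /fz : 0 < RtoC e by rewrite ltr_RtoC.
  move=> /nbhs_normP[d /= /posC_real[y y0 ->] dH].
  exists y => // w wz.
  have [->|wnz] := eqVneq w z.
    by rewrite !subrr mulr0 subr0 cabs0 mulr0.
  have wz0 : w - z != 0 by rewrite subr_eq0.
  have /= := dH (w - z).
  rewrite sub0r normrN !normCE !ltr_RtoC => /(_ wz wz0).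
  rewrite scaler1 subrK => /ltW H.
  have -> : f w - f z - l * (w - z)
      = - ((w - z) * (l - (w - z)^-1 *: (f w - f z))).
    by rewrite /GRing.scale /=; field.
  by rewrite cabsN cabsM mulrC ler_wpM2r ?cabs_ge0.
move=> [l H]; apply/cvg_ex; exists l; apply/cvgrPdist_le => e /posC_real[x x0 ->].
have [d d0 dH] := H _ x0.
apply/nbhs_normP; exists (RtoC d); first by rewrite /= ltr_RtoC.
move=> h /=; rewrite sub0r normrN !normCE ltr_RtoC => hd h0.
have := dH (h + z); rewrite addrK => /(_ hd) {}dH.
rewrite ler_RtoC scaler1 -(ler_pM2l (_ : 0 < cabs h)) ?cabs_gt0// -cabsM.
rewrite -cabsN [cabs h * _]mulrC.
by apply: le_trans dH; rewrite le_eqVlt; apply/orP; left; apply/eqP; congr cabs;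
  rewrite /GRing.scale /=; field.
Qed.

Lemma derivable_continuousC (f : C -> C) z :
  derivable f z 1 -> {for z, continuous f}.
Proof. by move=> /derivable1_diffP/differentiable_continuous. Qed.

Lemma derivable_compC (f g : C -> C) z :
  derivable g z 1 -> derivable f (g z) 1 -> derivable (f \o g) z 1.
Proof.
move=> /derivable1_diffP dg /derivable1_diffP df.
by apply/derivable1_diffP; apply: (differentiable_comp dg df).
Qed.

End ComplexModulus.

(** * Goursat's lemma for left-endpoint Riemann sums *)

Section DiscreteGoursat.
Variable R : realType.
Local Notation C := (C R).
Implicit Types (G : C -> C) (p d w v : C).

(** Left-endpoint Riemann sum, with [2 ^ n] steps, of the integral of [G] from [p] to [p + d]. The
    recursion by halving matches the bisection; [edge_sumE] recovers the flat sum. *)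
Fixpoint edge_sum G n p d : C :=
  if n is m.+1 then edge_sum G m p (d / 2) + edge_sum G m (p + d / 2) (d / 2)
  else G p * d.

(** Boundary of the parallelogram spanned by [w] and [v] at [p]. The last two edges are sampled in
    the direction of their opposites and subtracted, so that shared edges use identical sample
    points. *)
Definition contour_sum G n p w v : C :=
  edge_sum G n p w + edge_sum G n (p + w) v
  - edge_sum G n (p + v) w - edge_sum G n p v.

Lemma edge_sumE G n p d :
  edge_sum G n p d =
  d / (2 ^ n)%:R * \sum_(j < 2 ^ n) G (p + j%:R / (2 ^ n)%:R * d).
Proof.
elim: n p d => [|n IH] p d /=.
  by rewrite expn0 big_ord1 mul0r mul0r addr0 divr1 mulrC.
have n20 : (2 ^+ n : C) != 0 by rewrite expf_neq0// pnatr_eq0.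
rewrite !IH expnS mul2n -addnn big_split_ord/= mulrDr !natrX.
rewrite addnn -mul2n natrM natrX.
congr (_ + _).
  have -> : d / 2 / 2 ^+ n = d / (2 * 2 ^+ n) by field; rewrite n20 ?pnatr_eq0.
  congr (_ * _); apply: eq_bigr => j _; congr (G (_ + _)).
  by field; rewrite n20 ?pnatr_eq0.
have -> : d / 2 / 2 ^+ n = d / (2 * 2 ^+ n) by field; rewrite n20 ?pnatr_eq0.
congr (_ * _); apply: eq_bigr => j _; congr (G _).
rewrite natrD natrX.
by field; rewrite n20 ?pnatr_eq0.
Qed.

(** Each inner edge belongs to two quarters with opposite signs, so the cancellation is exact at
    every finite level. *)
Lemma contour_sumS G n p w v :
  contour_sum G n.+1 p w v =
    contour_sum G n p (w / 2) (v / 2)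
  + contour_sum G n (p + w / 2) (w / 2) (v / 2)
  + contour_sum G n (p + v / 2) (w / 2) (v / 2)
  + contour_sum G n (p + w / 2 + v / 2) (w / 2) (v / 2).
Proof.
have n2 : (2 : C) != 0 by rewrite pnatr_eq0.
rewrite /contour_sum /=.
have -> : p + w / 2 + w / 2 = p + w by field.
have -> : p + v / 2 + v / 2 = p + v by field.
have -> : p + v / 2 + w / 2 = p + w / 2 + v / 2 by field.
have -> : p + w / 2 + v / 2 + w / 2 = p + w + v / 2 by field.
have -> : p + w / 2 + v / 2 + v / 2 = p + v + w / 2 by field.
ring.
Qed.

Lemma edge_sumB G H n p d :
  edge_sum (fun z => G z - H z) n p d = edge_sum G n p d - edge_sum H n p d.
Proof.
elim: n p d => [|n IH] p d /=; first by rewrite mulrBl.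
by rewrite !IH; ring.
Qed.

Lemma edge_sum_affine (c l e : C) n p d :
  edge_sum (fun z => c + l * z) n (p + e) d =
  edge_sum (fun z => c + l * z) n p d + l * e * d.
Proof.
elim: n p d => [|n IH] p d /=; first by ring.
have -> : p + e + d / 2 = p + d / 2 + e by ring.
by rewrite !IH; field.
Qed.

(** Left sums of an affine map are not exact integrals, but parallel edges have equal errors:
    translating the [w] edge by [v] and the [v] edge by [w] both add [l * v * w]. *)
Lemma contour_sum_affine (c l : C) n p w v :
  contour_sum (fun z => c + l * z) n p w v = 0.
Proof. by rewrite /contour_sum !edge_sum_affine; ring. Qed.

Lemma contour_sum_sub_affine G (c l : C) n p w v :
  contour_sum (fun z => G z - (c + l * z)) n p w v = contour_sum G n p w v.
Proof.
rewrite -[RHS]subr0 -(contour_sum_affine c l n p w v).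
by rewrite /contour_sum !edge_sumB; ring.
Qed.

Lemma cabs_edge_sum G (B : R) n p d :
  (forall t : R, 0 <= t <= 1 -> cabs (G (p + RtoC t * d)) <= B) ->
  cabs (edge_sum G n p d) <= B * cabs d.
Proof.
have h2 : RtoC (2 : R) = 2 by rewrite RtoC_nat.
have n2 : (2 : C) != 0 by rewrite pnatr_eq0.
elim: n p d => [|n IH] p d H /=.
  have := H 0; rewrite lexx ler01 RtoC0 mul0r addr0 => /(_ isT) Hp.
  by rewrite cabsM ler_wpM2r ?cabs_ge0.
have d2 : cabs (d / 2) = cabs d / 2 by rewrite cabsM cabsV cabs_nat.
apply: le_trans (cabsD _ _) _.
have -> : B * cabs d = B * cabs (d / 2) + B * cabs (d / 2).
  by rewrite d2; field.
apply: lerD; apply: IH => t /andP[t0 t1].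
  have -> : RtoC t * (d / 2) = RtoC (t / 2) * d.
    by rewrite RtoCM RtoCV h2; field.
  by apply: H; apply/andP; split; lra.
have -> : p + d / 2 + RtoC t * (d / 2) = p + RtoC ((1 + t) / 2) * d.
  by rewrite RtoCM RtoCV h2 RtoCD RtoC1; field.
by apply: H; apply/andP; split; lra.
Qed.

Lemma cabs_contour_sum G (B : R) n p w v :
  (forall s t : R, 0 <= s <= 1 -> 0 <= t <= 1 ->
     cabs (G (p + RtoC s * w + RtoC t * v)) <= B) ->
  cabs (contour_sum G n p w v) <= 2 * B * (cabs w + cabs v).
Proof.
move=> H.
have h0 : (0 : R) <= (0 : R) <= 1 by rewrite lexx ler01.
have h1 : (0 : R) <= (1 : R) <= 1 by rewrite ler01 lexx.
have -> : 2 * B * (cabs w + cabs v) = B * cabs w + B * cabs v + B * cabs w + B * cabs v.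
  by ring.
apply: le_trans (cabsB _ _) _; apply: lerD; last first.
- apply: cabs_edge_sum => t ht; have := H 0 t h0 ht.
  by rewrite RtoC0 mul0r addr0.
apply: le_trans (cabsB _ _) _; apply: lerD; last first.
- apply: cabs_edge_sum => t ht; have := H t 1 ht h1.
  by rewrite RtoC1 mul1r addrAC.
apply: le_trans (cabsD _ _) _; apply: lerD.
- apply: cabs_edge_sum => t ht; have := H t 0 ht h0.
  by rewrite RtoC0 mul0r addr0.
- apply: cabs_edge_sum => t ht; have := H 1 t h1 ht.
  by rewrite RtoC1 mul1r.
Qed.

(** Holding for infinitely many indices: this survives the pigeonhole over finitely many
    alternatives. *)
Definition often (P : nat -> Prop) := forall m, exists2 n, (m <= n)%N & P n.

Lemma often_or (P Q : nat -> Prop) :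
  often (fun n => P n \/ Q n) -> often P \/ often Q.
Proof.
move=> H; apply: contrapT => /not_orP[] /existsNP[m1 H1] /existsNP[m2 H2].
have [n nm [Pn|Qn]] := H (maxn m1 m2).
  by apply: H1; exists n => //; apply: leq_trans nm; rewrite leq_maxl.
by apply: H2; exists n => //; apply: leq_trans nm; rewrite leq_maxr.
Qed.

Lemma often_quarter G (e : R) p w v :
  often (fun n => e <= cabs (contour_sum G n p w v)) ->
  exists s t : bool, often (fun n =>
    e / 4 <= cabs (contour_sum G n (p + s%:R * (w / 2) + t%:R * (v / 2))
                                (w / 2) (v / 2))).
Proof.
move=> H.
pose A (s t : bool) n :=
    e / 4 <= cabs (contour_sum G n (p + s%:R * (w / 2) + t%:R * (v / 2))
                                (w / 2) (v / 2)).
have : often (fun n => ((A false false n \/ A true false n) \/ A false true n)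
                       \/ A true true n).
  (* An index beyond [m.+1] is a successor, so the subdivision formula applies and its predecessor
     is still at least [m]. *)
  move=> m; have [[//|n] mn] := H m.+1.
  rewrite contour_sumS => en; exists n => //.
  apply: contrapT => /not_orP[/not_orP[/not_orP[]]].
  rewrite /A !mulr0n !mulr1n !mul0r !mul1r !addr0.
  move=> /negP + /negP + /negP + /negP; rewrite -!ltNge => a1 a2 a3 a4.
  move: en; apply/negP; rewrite -ltNge.
  have b1 := cabsD (contour_sum G n p (w / 2) (v / 2))
     (contour_sum G n (p + w / 2) (w / 2) (v / 2)).
  have b2 := cabsD (contour_sum G n p (w / 2) (v / 2) +
     contour_sum G n (p + w / 2) (w / 2) (v / 2))
     (contour_sum G n (p + v / 2) (w / 2) (v / 2)).
  apply: le_lt_trans (cabsD _ _) _; lra.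
case/often_or => [/often_or[/often_or[]|]|] h.
- by exists false, false.
- by exists true, false.
- by exists false, true.
- by exists true, true.
Qed.

(** The increments after index [k] add up to at most [2 ^- k], so the supremum lies in every one of
    the intervals. *)
Lemma dyadic_limit (X : nat -> R) :
  (forall k, X k <= X k.+1 <= X k + 2 ^- k.+1) ->
  exists x, forall k, X k <= x <= X k + 2 ^- k.
Proof.
move=> H.
have le1 k j : X k <= X (k + j)%N <= X k + 2 ^- k - 2 ^- (k + j).
  elim: j => [|j /andP[IH1 IH2]]; first by rewrite addn0 addrK lexx.
  have /andP[h1 h2] := H (k + j)%N; rewrite addnS.
  have : (2 ^- (k + j).+1 : R) * 2 = 2 ^- (k + j).
    by rewrite exprS; field; rewrite expf_neq0.
  by move: h1 h2 IH1 IH2; set u := 2 ^- _; set u' := 2 ^- _ => *;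
    apply/andP; split; lra.
have ub k j : X j <= X k + 2 ^- k.
  have p0 i : 0 <= (2 ^- i : R) by rewrite invr_ge0 exprn_ge0.
  have [jk|kj] := leqP j k.
    have /andP[+ _] := le1 j (k - j)%N; rewrite subnKC// => /le_trans; apply.
    by rewrite lerDl.
  have /andP[_] := le1 k (j - k)%N; rewrite subnKC 1?ltnW// => /le_trans; apply.
  by rewrite gerBl.
have hs : has_sup (range X).
  by split; [exists (X 0%N), 0%N | exists (X 0%N + 2 ^- 0) => _ [j _ <-]].
exists (sup (range X)) => k; apply/andP; split.
  by apply: sup_upper_bound => //; exists k.
by apply: sup_le_ub; [case: hs | move=> _ [j _ <-]].
Qed.

Lemma exists_pow2_gt (x : R) : exists k, x < 2 ^+ k.
Proof.
exists (Num.bound `|x|); apply: lt_le_trans (_ : (Num.bound `|x|)%:R <= _).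
  exact: le_lt_trans (ler_norm x) (archi_boundP (normr_ge0 x)).
by rewrite -natrX ler_nat ltnW// ltn_expl.
Qed.

(* Goursat's bisection applied to the property "infinitely many Riemann sums
   are large", which always passes to one of the four quarters. *)
Theorem contour_sum_cvg0 G p w v :
  (forall x y : R, 0 <= x <= 1 -> 0 <= y <= 1 ->
     derivable G (p + RtoC x * w + RtoC y * v) 1) ->
  forall e : R, 0 < e ->
  exists N, forall n, (N <= n)%N -> cabs (contour_sum G n p w v) < e.
Proof.
move=> dG e e0; apply: contrapT => nH.
have n2 : (2 : R) != 0 by rewrite pnatr_eq0.
have n2C : (2 : C) != 0 by rewrite pnatr_eq0.
have n2X k : (2 ^+ k : C) != 0 by rewrite expf_neq0.
have n2XR k : (2 ^+ k : R) != 0 by rewrite expf_neq0.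
pose pt (x y : R) := p + RtoC x * w + RtoC y * v.
pose bad k (q : R * R) := often (fun n =>
  e / 4 ^+ k <= cabs (contour_sum G n (pt q.1 q.2) (w / 2 ^+ k) (v / 2 ^+ k))).
have bad0 : bad 0%N (0, 0).
  move=> m; apply: contrapT => h; apply: nH; exists m => n mn.
  rewrite ltNge; apply/negP => h'; apply: h; exists n => //.
  by rewrite /pt/= !expr0 RtoC0 !mul0r !addr0 !divr1.
(* The choice of a quarter is made total: where nothing is bad, [(false, false)] is a dummy
   value. *)
have step kq : exists st : bool * bool, bad kq.1 kq.2 ->
    bad kq.1.+1 (kq.2.1 + st.1%:R / 2 ^+ kq.1.+1, kq.2.2 + st.2%:R / 2 ^+ kq.1.+1).
  case: kq => k [x y]/=.
  have [/often_quarter[s [t h]]|?] := pselect (bad k (x, y)); last first.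
    by exists (false, false).
  exists (s, t) => _ m; have [n mn {}h] := h m; exists n => //=.
  have -> : e / 4 ^+ k.+1 = e / 4 ^+ k / 4.
    by rewrite exprSr; field; rewrite expf_neq0.
  have E u : u / 2 ^+ k.+1 = u / 2 ^+ k / 2 :> C.
    by rewrite exprSr; field; rewrite n2X.
  apply: le_trans h _; rewrite !E le_eqVlt; apply/orP; left; apply/eqP.
  congr (cabs (contour_sum _ _ _ _ _)); rewrite /pt/= -!E.
  rewrite !RtoCD !RtoCM !RtoCV !RtoCX !RtoC_nat; ring.
have [f fP] := choice step.
pose q := fix q k : R * R := if k is k'.+1 then
   ((q k').1 + (f (k', q k')).1%:R / 2 ^+ k'.+1,
    (q k').2 + (f (k', q k')).2%:R / 2 ^+ k'.+1) else (0, 0).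
have badq k : bad k (q k) by elim: k => //= k IH; apply: (fP (k, q k)).
have bnat (b : bool) k (u : R) : u <= u + b%:R / 2 ^+ k <= u + 2 ^- k.
  have : 0 <= (2 ^- k : R) by rewrite invr_ge0 exprn_ge0.
  by case: b; rewrite ?mul1r ?mul0r ?addr0 ?lexx ?lerDl => ->.
have [x xP] : exists x, forall k, (q k).1 <= x <= (q k).1 + 2 ^- k.
  by apply: dyadic_limit => k /=; exact: bnat.
have [y yP] : exists y, forall k, (q k).2 <= y <= (q k).2 + 2 ^- k.
  by apply: dyadic_limit => k /=; exact: bnat.
have /derivable_cabsP[l lP] : derivable G (pt x y) 1.
  have := xP 0%N; have := yP 0%N; rewrite /= expr0 invr1 !add0r => hy hx.
  exact: dG.
pose D : R := cabs w + cabs v.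
have D0 : 0 <= D by rewrite addr_ge0 ?cabs_ge0.
have K0 : 0 < 2 * D ^+ 2 + 1 by rewrite ltr_wpDl ?mulr_ge0 ?sqr_ge0.
(* Calibrated so that [2 * e' * D ^+ 2 < e]; the added [1] keeps the denominator positive when
   [D = 0]. *)
pose e' := e / (2 * D ^+ 2 + 1).
have e'0 : 0 < e' by rewrite divr_gt0.
have [d d0 dP] := lP _ e'0.
have [k kP] := exists_pow2_gt (D / d).
have h0 : 0 < (2 ^- k : R) by rewrite invr_gt0 exprn_gt0.
have hD : 2 ^- k * D < d.
  by rewrite mulrC ltr_pdivrMr ?exprn_gt0// mulrC -ltr_pdivrMr.
have [n _] := badq k 0%N; apply/negP; rewrite -ltNge.
(* Removing the tangent map at the limit point does not change the sum. The remainder is at most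
   [e' * (2 ^- k * D)] along edges of total size of order [2 ^- k * D], which gives less than
   [e / 4 ^+ k]. *)
rewrite -(contour_sum_sub_affine _ (G (pt x y) - l * pt x y) l).
apply: le_lt_trans (cabs_contour_sum (B := e' * (2 ^- k * D)) _ _) _.
  move=> s t /andP[s0 s1] /andP[t0 t1]; set z := (X in G X).
  have zE : z - pt x y = RtoC ((q k).1 + s * 2 ^- k - x) * w
                       + RtoC ((q k).2 + t * 2 ^- k - y) * v.
    rewrite /z /pt !RtoCB !RtoCD !RtoCM !RtoCV !RtoCX !RtoC_nat.
    by field; rewrite n2X.
  have hz : cabs (z - pt x y) <= 2 ^- k * D.
    rewrite zE; apply: le_trans (cabsD _ _) _; rewrite !cabsM !cabs_RtoC mulrDr.
    have aux (X s' x' : R) : 0 <= s' -> s' <= 1 -> X <= x' <= X + 2 ^- k ->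
        `|X + s' * 2 ^- k - x'| <= 2 ^- k.
      move=> ? ? /andP[]; move: h0; set u := 2 ^- k => *; rewrite ler_norml.
      by apply/andP; split; nra.
    by apply: lerD; apply: ler_wpM2r; rewrite ?cabs_ge0//; apply: aux.
  have -> : G z - (G (pt x y) - l * pt x y + l * z)
          = G z - G (pt x y) - l * (z - pt x y) by ring.
  apply: le_trans (dP z (le_lt_trans hz hD)) _.
  by rewrite ler_wpM2l// ltW.
have -> : cabs (w / 2 ^+ k) + cabs (v / 2 ^+ k) = 2 ^- k * D.
  by rewrite !cabsM !cabsV !cabsX !cabs_nat /D; ring.
have -> : 2 * (e' * (2 ^- k * D)) * (2 ^- k * D) = (e' * (2 * D ^+ 2)) / 4 ^+ k.
  have -> : (4 : R) = 2 ^+ 2 by rewrite -natrX.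
  by rewrite -exprM mulnC exprM; field.
rewrite ltr_pM2r ?invr_gt0 ?exprn_gt0//.
rewrite /e' mulrAC ltr_pdivrMr// ltr_pM2l//; lra.
Qed.

End DiscreteGoursat.

(** * The complex exponential *)

Section ComplexExponential.
Variable R : realType.
Local Notation C := (C R).
Implicit Types (z w : C).

Lemma cexpD z w : cexp (z + w) = cexp z * cexp w.
Proof.
case: z w => [a b] [c d]; rewrite /cexp /= expRD cosD sinD RtoCM.
have -> : (Complex (cos b * cos d - sin b * sin d) (sin b * cos d + cos b * sin d) : C)
  = (Complex (cos b) (sin b) : C) * (Complex (cos d) (sin d) : C).
  by apply/eqP; rewrite eq_complex/=; apply/andP; split; apply/eqP; ring.
ring.
Qed.

Lemma cexp0 : cexp (0 : C) = 1.
Proof. by rewrite /cexp /= expR0 cos0 sin0 mul1r. Qed.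

Lemma cexp_neq0 z : cexp z != 0.
Proof.
apply/eqP => h; have := cexpD z (- z); rewrite subrr cexp0 h mul0r.
by move/eqP; rewrite oner_eq0.
Qed.

Lemma cexp_natM n z : cexp (n%:R * z) = cexp z ^+ n.
Proof.
elim: n => [|n IH]; first by rewrite mul0r cexp0 expr0.
by rewrite -natr1 mulrDl mul1r cexpD IH exprSr.
Qed.

Lemma cabs_cexp z : cabs (cexp z) = expR (complex.Re z).
Proof.
rewrite /cexp cabsM cabs_RtoC ger0_norm ?expR_ge0// cabsE/= cos2Dsin2.
by rewrite sqrtr1 mulr1.
Qed.

Definition iR (x : R) : C := Complex 0 x.

Lemma iRM (x y : R) : RtoC x * iR y = iR (x * y).
Proof.
by apply/eqP; rewrite eq_complex/= !mul0r mulr0 subr0 addr0 !eqxx.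
Qed.

Lemma iRN (x : R) : iR (- x) = - iR x.
Proof. by apply/eqP; rewrite eq_complex/= oppr0 !eqxx. Qed.

Lemma cexp_iR2pi : cexp (iR (pi *+ 2)) = 1.
Proof. by rewrite /cexp/= expR0 cos2pi sin2pi mul1r. Qed.

Lemma cexp_periodic z : cexp (z + iR (pi *+ 2)) = cexp z.
Proof. by rewrite cexpD cexp_iR2pi mulr1. Qed.

(** The real part is [1 - 2 * sin (x / 2) ^+ 2], and [x / 2] lies strictly between [0] and [pi]. *)
Lemma cexp_iR_neq1 (x : R) : 0 < x < pi *+ 2 -> cexp (iR x) != 1.
Proof.
move=> /andP[x0 x2]; apply/eqP => /(congr1 (@complex.Re R)) /=.
rewrite expR0 mul1r mul0r subr0 => cx.
have s0 : 0 < sin (x / 2).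
  by apply: sin_gt0_pi; rewrite divr_gt0//= ltr_pdivrMr// mulr_natr.
have : cos x = 1 - sin (x / 2) ^+ 2 *+ 2.
  rewrite {1}(_ : x = (x / 2) *+ 2); last by rewrite -mulr_natr divfK ?pnatr_eq0.
  by rewrite cos_mulr2n cos2sin2; ring.
rewrite cx; have := exprn_gt0 2 s0; rewrite -mulr_natr; lra.
Qed.

Lemma real_derivable_small (f : R -> R) (l : R) : is_derive (0 : R) (1 : R) f l ->
  forall e : R, 0 < e -> exists2 d : R, 0 < d &
    forall x, `|x| < d -> `|f x - f 0 - l * x| <= e * `|x|.
Proof.
move=> [df fl] e e0.
have : (fun h => h^-1 *: (f (h *: 1 + 0) - f 0)) @ 0^' --> l.
  by rewrite -fl; exact: df.
move=> /cvgrPdist_le /(_ e e0) /nbhs_normP[d /= d0 dH].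
exists d => // x xd; have [->|x0] := eqVneq x 0.
  by rewrite subrr mulr0 subr0 normr0 mulr0.
have := dH x; rewrite /ball_ /= sub0r normrN => /(_ xd x0).
rewrite addr0 /GRing.scale/= mulr1 => h.
have -> : f x - f 0 - l * x = - (x * (l - x^-1 * (f x - f 0))) by field.
by rewrite normrN normrM mulrC ler_wpM2r.
Qed.

(** The functional equation reduces the claim to the point [0], where the derivatives of [expR],
    [cos] and [sin] control the real and imaginary parts. *)
Lemma derivable_cexp z : derivable (@cexp R) z 1.
Proof.
suff H : forall e : R, 0 < e -> exists2 d : R, 0 < d &
    forall h : C, cabs h < d -> cabs (cexp h - 1 - h) <= e * cabs h.
  apply/derivable_cabsP; exists (cexp z) => e e0.
  have Z0 : 0 < cabs (cexp z) by rewrite cabs_gt0 cexp_neq0.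
  have [d d0 dH] := H _ (divr_gt0 e0 Z0).
  exists d => // w wz; have -> : cexp w = cexp z * cexp (w - z).
    by rewrite -cexpD addrC subrK.
  have -> : cexp z * cexp (w - z) - cexp z - cexp z * (w - z)
     = cexp z * (cexp (w - z) - 1 - (w - z)) by ring.
  rewrite cabsM; apply: le_trans (ler_wpM2l (ltW Z0) (dH _ wz)) _.
  by rewrite mulrA mulrCA divff ?mulr1// gt_eqF.
move=> e e0.
(* With [r = cabs h < t], the bounds on the error terms below total [8 * (t * r)]. *)
have [t [t0 t1 te]] : exists t : R, [/\ 0 < t, t <= 1 & t <= e / 8].
  exists (Num.min (e / 8) 1); split; last 2 first.
  - by rewrite ge_min lexx orbT.
  - by rewrite ge_min lexx.
  by rewrite lt_min divr_gt0/=.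
have [d1 d10 H1] := real_derivable_small (is_derive_expR 0) t0.
have [d2 d20 H2] := real_derivable_small (is_derive_cos 0) t0.
have [d3 d30 H3] := real_derivable_small (is_derive_sin 0) t0.
exists (Num.min t (Num.min d1 (Num.min d2 d3))); first by rewrite !lt_min t0 d10 d20.
move=> h; rewrite !lt_min => /andP[ht /andP[h1 /andP[h2 h3]]].
have hx := cabs_Re h; have hy := cabs_Im h.
case: h ht h1 h2 h3 hx hy => x y /=; set r := cabs _ => ht h1 h2 h3 hx hy.
have r0 : 0 <= r by apply: cabs_ge0.
have := H1 x (le_lt_trans hx h1); rewrite expR0 mul1r => {}H1.
have := H2 y (le_lt_trans hy h2); rewrite cos0 sin0 oppr0 mul0r subr0 => {}H2.
have := H3 y (le_lt_trans hy h3); rewrite sin0 cos0 subr0 mul1r => {}H3.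
apply: le_trans (cabs_le_ReIm _) _; rewrite /= !mul0r subr0 addr0.
have B1 : `|expR x - 1 - x| <= t * r by apply: le_trans H1 _; rewrite ler_pM2l.
have B2 : `|cos y - 1| <= t * r by apply: le_trans H2 _; rewrite ler_pM2l.
have B3 : `|sin y - y| <= t * r by apply: le_trans H3 _; rewrite ler_pM2l.
have r1 : r <= 1 by apply: ltW; apply: lt_le_trans ht t1.
have E1 : expR x * cos y - 1 - x
  = (expR x - 1 - x) * cos y + (1 + x) * (cos y - 1) by ring.
have E2 : expR x * sin y - 0 - y
  = (expR x - 1 - x) * (sin y - y) + (1 + x) * (sin y - y)
    + (expR x - 1 - x) * y + x * y by ring.
have cy : `|cos y| <= 1 by rewrite ler_norml cos_geN1 cos_le1.
have x1 : `|1 + x| <= 2.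
  by apply: le_trans (ler_normD _ _) _; rewrite normr1; lra.
have tr0 : 0 <= t * r by rewrite mulr_ge0// ltW.
have tr1 : t * r <= 1 by rewrite mulr_ile1// ltW.
have prod (a b c d : R) : `|a| <= c -> `|b| <= d -> `|a * b| <= c * d.
  by move=> ? ?; rewrite normrM ler_pM.
have P1 := prod _ _ _ _ B1 cy.
have P2 := prod _ _ _ _ x1 B2.
have P3 := prod _ _ _ _ B1 B3.
have P4 := prod _ _ _ _ x1 B3.
have P5 := prod _ _ _ _ B1 hy.
have P6 := prod _ _ _ _ hx hy.
have P3' : t * r * (t * r) <= t * r by rewrite ler_piMr.
have P5' : t * r * r <= t * r by rewrite ler_piMr.
have P6' : r * r <= t * r by rewrite ler_wpM2r// ltW.
have er : 8 * (t * r) <= e * r by rewrite mulrA ler_wpM2r//; lra.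
have M1 := ler_normD ((expR x - 1 - x) * cos y) ((1 + x) * (cos y - 1)).
have M2 := ler_normD ((expR x - 1 - x) * (sin y - y) + (1 + x) * (sin y - y)
    + (expR x - 1 - x) * y) (x * y).
have M3 := ler_normD ((expR x - 1 - x) * (sin y - y) + (1 + x) * (sin y - y))
    ((expR x - 1 - x) * y).
have M4 := ler_normD ((expR x - 1 - x) * (sin y - y)) ((1 + x) * (sin y - y)).
rewrite E1 E2; lra.
Qed.

End ComplexExponential.

(** * Means over equidistributed points of a circle *)

Section CircleMeans.
Variable R : realType.
Local Notation C := (C R).
Implicit Types (h F : C -> C).

Local Notation tau := (iR (pi *+ 2 : R)).

(* The radius is parametrised as [expR s]. *)
Definition circle_node n (s : R) (j : nat) : C :=
  cexp (RtoC s + j%:R / (2 ^ n)%:R * tau).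

Definition circle_mean h n (s : R) : C :=
  (2 ^ n)%:R^-1 * \sum_(j < 2 ^ n) h (circle_node n s j).

Lemma pow2_neq0 n : ((2 ^ n)%:R : C) != 0.
Proof. by rewrite pnatr_eq0 expn_eq0. Qed.

Lemma tau_neq0 : tau != 0 :> C.
Proof.
rewrite eq_complex/= negb_and; apply/orP; right.
by rewrite mulrn_eq0/= gt_eqF ?pi_gt0.
Qed.

Lemma cabs_circle_node n s j : cabs (circle_node n s j) = expR s.
Proof.
rewrite /circle_node cabs_cexp -RtoC_nat -(RtoC_nat _ (2 ^ n)) -RtoCV -RtoCM iRM.
by rewrite /= addr0.
Qed.

Lemma circle_node_neq0 n s j : circle_node n s j != 0.
Proof. exact: cexp_neq0. Qed.

Lemma circle_nodeX n s j : circle_node n s j ^+ (2 ^ n) = cexp (RtoC s) ^+ (2 ^ n).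
Proof.
rewrite /circle_node -!cexp_natM mulrDr cexpD.
have -> : (2 ^ n)%:R * (j%:R / (2 ^ n)%:R * tau) = j%:R * tau.
  by field; rewrite pow2_neq0.
by rewrite (cexp_natM j) cexp_iR2pi expr1n mulr1.
Qed.

(** A geometric sum over the powers of a nontrivial [2 ^ n]-th root of unity, namely [x^-1]
    below. *)
Lemma sum_circle_nodeVX n s k : (0 < k < 2 ^ n)%N ->
  \sum_(j < 2 ^ n) (circle_node n s j)^-1 ^+ k = 0.
Proof.
move=> /andP[k0 kn].
pose x : C := cexp (iR ((pi *+ 2) * (k%:R / (2 ^ n)%:R))).
have n0 : 0 < (2 ^ n)%:R :> R by rewrite ltr0n expn_gt0.
have x1 : x != 1.
  apply: cexp_iR_neq1; have p0 : 0 < pi *+ 2 :> R by rewrite mulrn_wgt0// pi_gt0.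
  apply/andP; split; first by rewrite mulr_gt0// divr_gt0// ltr0n.
  by rewrite gtr_pMr// ltr_pdivrMr// mul1r ltr_nat.
have xE j : (circle_node n s j)^-1 ^+ k = cexp (RtoC s) ^- k * x^-1 ^+ j.
  rewrite -!exprVn /circle_node cexpD invfM exprMn; congr (_ * _).
  rewrite !exprVn -cexp_natM -cexp_natM; congr (cexp _)^-1.
  by rewrite mulrC (mulrC (pi *+ 2)) -iRM RtoCM RtoCV !RtoC_nat; ring.
under eq_bigr do rewrite xE.
rewrite -big_distrr/=; apply/eqP; rewrite mulf_eq0; apply/orP; right.
have x1' : x^-1 - 1 != 0.
  by rewrite subr_eq0 -invr1 (inj_eq invr_inj).
rewrite -(inj_eq (mulfI x1')) mulr0 -subrX1 subr_eq0 exprVn -cexp_natM.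
have -> : (2 ^ n)%:R * iR (pi *+ 2 * (k%:R / (2 ^ n)%:R)) = k%:R * tau.
  by rewrite -!RtoC_nat !iRM; congr iR; field; rewrite gt_eqF.
by rewrite cexp_natM cexp_iR2pi expr1n invr1.
Qed.

(** In logarithmic coordinates a circle becomes a vertical segment of length [2 pi], and the measure
    [dz / z] becomes [du]. *)
Lemma edge_sum_circle h n s :
  edge_sum (h \o @cexp R) n (RtoC s) tau = tau * circle_mean h n s.
Proof. by rewrite edge_sumE /circle_mean mulrA. Qed.

(** The Riemann sums of [h] composed with [cexp] are taken around the rectangle with sides [s' - s]
    and [tau]. The horizontal edges cancel by periodicity, and the vertical ones give [tau] times
    the difference of the means. *)
Lemma circle_mean_radius h (s s' : R) :
  (forall x : R, 0 <= x <= 1 ->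
     forall z : C, cabs z = expR (s + x * (s' - s)) -> derivable h z 1) ->
  forall e : R, 0 < e -> exists N, forall n, (N <= n)%N ->
    cabs (circle_mean h n s' - circle_mean h n s) < e.
Proof.
move=> dh e e0.
have T0 : 0 < cabs tau by rewrite cabs_gt0 tau_neq0.
have [|N NH] := contour_sum_cvg0 (G := h \o @cexp R) (p := RtoC s)
    (w := RtoC (s' - s)) (v := tau) _ (mulr_gt0 e0 T0).
  move=> x y x01 y01; apply: derivable_compC; first exact: derivable_cexp.
  apply: (dh x x01); rewrite cabs_cexp; congr expR.
  by rewrite iRM -RtoCM -RtoCD /= addr0.
exists N => n /NH; rewrite /contour_sum -RtoCD (addrC s) subrK !edge_sum_circle.
have -> : edge_sum (h \o @cexp R) n (RtoC s + tau) (RtoC (s' - s))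
        = edge_sum (h \o @cexp R) n (RtoC s) (RtoC (s' - s)).
  rewrite !edge_sumE; congr (_ * _); apply: eq_bigr => j _ /=.
  by rewrite addrAC cexp_periodic.
set a := edge_sum _ _ _ _; have -> : a + tau * circle_mean h n s' - a - tau * circle_mean h n s
  = (circle_mean h n s' - circle_mean h n s) * tau by ring.
by rewrite cabsM ltr_pM2r.
Qed.

Lemma cabs_circle_mean h (B : R) n s :
  (forall j, (j < 2 ^ n)%N -> cabs (h (circle_node n s j)) <= B) ->
  cabs (circle_mean h n s) <= B.
Proof.
move=> H; rewrite /circle_mean cabsM cabsV cabs_nat.
have n0 : 0 < (2 ^ n)%:R :> R by rewrite ltr0n expn_gt0.
rewrite ler_pdivrMl//; apply: le_trans (cabs_sum _ _ _) _.
apply: le_trans (ler_sum _ (_ : forall j : 'I_(2 ^ n), true -> _ <= B)) _.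
  by move=> j _; apply: H.
by rewrite sumr_const card_ord mulr_natl.
Qed.

Lemma circle_meanB h k n s s' :
  circle_mean h n s - circle_mean k n s' =
  (2 ^ n)%:R^-1 * \sum_(j < 2 ^ n) (h (circle_node n s j) - k (circle_node n s' j)).
Proof. by rewrite /circle_mean -mulrBr sumrB. Qed.

Lemma cabs_circle_meanB h k (B : R) n s s' :
  (forall t : R, 0 <= t <= 1 ->
    cabs (h (cexp (RtoC s + RtoC t * tau)) - k (cexp (RtoC s' + RtoC t * tau))) <= B) ->
  cabs (circle_mean h n s - circle_mean k n s') <= B.
Proof.
move=> H; rewrite circle_meanB cabsM cabsV cabs_nat.
have n0 : 0 < (2 ^ n)%:R :> R by rewrite ltr0n expn_gt0.
rewrite ler_pdivrMl//; apply: le_trans (cabs_sum _ _ _) _.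
apply: le_trans (ler_sum _ (_ : forall j : 'I_(2 ^ n), true -> _ <= B)) _.
  move=> j _; have := H (j%:R / (2 ^ n)%:R); rewrite RtoCM RtoCV !RtoC_nat; apply.
  rewrite divr_ge0 ?ler0n//= ler_pdivrMr// mul1r ler_nat ltnW//.
by rewrite sumr_const card_ord mulr_natl.
Qed.

(** Compactness of the parameter interval [[0, 1]] makes continuity along the circle uniform over
    nearby radii. *)
Lemma circle_tube h (s : R) : (forall z, cabs z = expR s -> {for z, continuous h}) ->
  forall e : R, 0 < e -> exists2 d : R, 0 < d & forall s', `|s' - s| < d ->
  forall t : R, 0 <= t <= 1 ->
    cabs (h (cexp (RtoC s' + RtoC t * tau)) - h (cexp (RtoC s + RtoC t * tau))) < e.
Proof.
move=> ch e e0.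
pose P (s' t : R) :=
  cabs (h (cexp (RtoC s' + RtoC t * tau)) - h (cexp (RtoC s + RtoC t * tau))) < e.
have /compact_near_coveringP cK := @segment_compact R 0 1.
have T0 : 0 < cabs tau by rewrite cabs_gt0 tau_neq0.
have := cK R (nbhs s) P (nbhs_filter s).
have cov : forall x : R, (`[0, 1] : set R) x -> \forall x' \near x & i \near nbhs s, P i x'.
  move=> x _; pose u := RtoC s + RtoC x * tau.
  have : {for u, continuous (h \o @cexp R)}.
    apply: continuous_comp; first exact/derivable_continuousC/derivable_cexp.
    by apply: ch; rewrite cabs_cexp /u iRM /= addr0.
  move=> /continuous_cabsP /(_ (e / 2)) []; first by rewrite divr_gt0.
  move=> d d0 dH.
  have d20 : 0 < d / 2 by rewrite divr_gt0.
  exists ([set t | `|x - t| < d / 2 / cabs tau], [set s' | `|s - s'| < d / 2]).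
    split; apply/nbhs_normP.
      by exists (d / 2 / cabs tau) => //=; rewrite divr_gt0.
    by exists (d / 2).
  move=> [t s'] [/= ht hs'].
  have At : cabs (RtoC (t - x) * tau) < d / 2.
    by rewrite cabsM cabs_RtoC distrC -ltr_pdivlMr.
  have B1 : cabs (RtoC s' + RtoC t * tau - u) < d.
    have -> : RtoC s' + RtoC t * tau - u = RtoC (s' - s) + RtoC (t - x) * tau.
      by rewrite /u !RtoCB; ring.
    apply: le_lt_trans (cabsD _ _) _.
    by rewrite cabs_RtoC distrC [ltRHS](splitr d) ltrD.
  have B2 : cabs (RtoC s + RtoC t * tau - u) < d.
    have -> : RtoC s + RtoC t * tau - u = RtoC (t - x) * tau.
      by rewrite /u !RtoCB; ring.
    by apply: lt_le_trans At _; rewrite ler_pdivrMr// ler_peMr ?ler1n ?ltW.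
  have := cabsB (h (cexp (RtoC s' + RtoC t * tau)) - h (cexp u))
    (h (cexp (RtoC s + RtoC t * tau)) - h (cexp u)).
  rewrite opprB addrA subrK => /le_lt_trans; apply.
  by rewrite (splitr e) ltrD// dH.
move=> /(_ cov) /nbhs_normP[d /= d0 dH].
exists d => // s' ss' t t01; apply: (dH s') => /=; first by rewrite distrC.
by rewrite in_itv.
Qed.

Lemma circle_bounded h (s : R) : (forall z, cabs z = expR s -> {for z, continuous h}) ->
  exists B : R, forall t : R, 0 <= t <= 1 -> cabs (h (cexp (RtoC s + RtoC t * tau))) <= B.
Proof.
move=> ch.
pose P (B t : R) := cabs (h (cexp (RtoC s + RtoC t * tau))) <= B.
have /compact_near_coveringP cK := @segment_compact R 0 1.
have T0 : 0 < cabs tau by rewrite cabs_gt0 tau_neq0.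
have := cK R +oo P _.
have cov : forall x : R, (`[0, 1] : set R) x -> \forall x' \near x & B \near +oo, P B x'.
  move=> x _; pose u := RtoC s + RtoC x * tau.
  have : {for u, continuous (h \o @cexp R)}.
    apply: continuous_comp; first exact/derivable_continuousC/derivable_cexp.
    by apply: ch; rewrite cabs_cexp /u iRM /= addr0.
  move=> /continuous_cabsP /(_ 1 ltr01) [d d0 dH].
  exists ([set t | `|x - t| < d / cabs tau], [set B | cabs (h (cexp u)) + 1 < B]).
    split.
      by apply/nbhs_normP; exists (d / cabs tau) => //=; rewrite divr_gt0.
    by exists (cabs (h (cexp u)) + 1); rewrite num_real; split.
  move=> [t B] [/= ht hB].
  have B2 : cabs (RtoC s + RtoC t * tau - u) < d.
    have -> : RtoC s + RtoC t * tau - u = RtoC (t - x) * tau.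
      by rewrite /u !RtoCB; ring.
    by rewrite cabsM cabs_RtoC distrC -ltr_pdivlMr.
  have /= := dH _ B2; have := cabsD (h (cexp (RtoC s + RtoC t * tau)) - h (cexp u)) (h (cexp u)).
  rewrite subrK /P; lra.
move=> /(_ _ cov) [B [_ BH]].
by exists (B + 1) => t t01; apply: (BH (B + 1)); rewrite ?ltrDl//= in_itv.
Qed.

(* The exceptional circle [cabs z = expR s0] is crossed by continuity. *)
Theorem circle_mean_value h (s0 s : R) : s0 < s ->
  continuous h ->
  (forall z, z != 0 -> cabs z != expR s0 -> derivable h z 1) ->
  forall e : R, 0 < e -> exists N, forall n, (N <= n)%N ->
    cabs (circle_mean h n s - h 0) < e.
Proof.
move=> s0s ch dh e e0.
have e5 : 0 < e / 5 by rewrite divr_gt0.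
have [d d0 dH] := circle_tube (h := h) (s := s0) (fun z _ => ch z) e5.
have [r r0 rH] := (continuous_cabsP h 0).1 (ch 0) _ e5.
(* The radii satisfy [s3 <= s2 < s0 < s1 <= s]: [s1] and [s2] are within the tube around [s0], and
   the circle for [s3] lies where [h] is within [e / 5] of [h 0]. *)
have [s1 [s01 s1s s1d]] : exists s1, [/\ s0 < s1, s1 <= s & s1 - s0 < d].
  exists (Num.min (s0 + d / 2) s); split.
  - by rewrite lt_min s0s ltrDl divr_gt0.
  - by rewrite ge_min lexx orbT.
  - rewrite -[ltRHS](addrK s0) ltrD2r gt_min; apply/orP; left.
    by rewrite addrC ltrD2r ltr_pdivrMr// ltr_pMr// ltr1n.
pose s2 := s0 - d / 2.
have s20 : s2 < s0 by rewrite gtrBl divr_gt0.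
have [s3 s32 s3r] : exists2 s3, s3 <= s2 & expR s3 < r.
  exists (Num.min s2 (ln (r / 2))); first by rewrite ge_min lexx.
  apply: le_lt_trans (_ : expR (ln (r / 2)) < r).
    by rewrite ler_expR ge_min lexx orbT.
  by rewrite lnK ?posrE ?divr_gt0// ltr_pdivrMr// ltr_pMr// ltr1n.
have nz z s' : cabs z = expR s' -> z != 0.
  by move=> zE; rewrite -cabs_gt0 zE expR_gt0.
have [|N1 H1] := circle_mean_radius (h := h) (s := s1) (s' := s) _ e5.
  move=> x /andP[x0 x1] z zE; apply: dh; first exact: nz zE.
  rewrite zE (inj_eq (@expR_inj R)) gt_eqF//.
  by apply: lt_le_trans s01 _; rewrite lerDl mulr_ge0// subr_ge0.
have [|N2 H2] := circle_mean_radius (h := h) (s := s3) (s' := s2) _ e5.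
  move=> x /andP[x0 x1] z zE; apply: dh; first exact: nz zE.
  rewrite zE (inj_eq (@expR_inj R)) lt_eqF//.
  by apply: le_lt_trans s20; nra.
exists (maxn N1 N2) => n; rewrite geq_max => /andP[/H1 {}H1 /H2 {}H2].
have A1 : cabs (circle_mean h n s1 - circle_mean h n s0) <= e / 5.
  apply: cabs_circle_meanB => t t01; apply/ltW/dH => //.
  by rewrite ger0_norm// subr_ge0 ltW.
have A2 : cabs (circle_mean h n s2 - circle_mean h n s0) <= e / 5.
  apply: cabs_circle_meanB => t t01; apply/ltW/dH => //.
  by rewrite distrC ger0_norm ?subr_ge0 ?ltW// /s2; lra.
have A3 : cabs (circle_mean h n s3 - h 0) <= e / 5.
  have -> : h 0 = circle_mean (fun=> h 0) n s3.
    by rewrite /circle_mean sumr_const card_ord -[h 0 *+ _]mulr_natl mulKf ?pow2_neq0.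
  rewrite circle_meanB -/(circle_mean (fun z => h z - h 0) n s3).
  apply: cabs_circle_mean => j _; apply/ltW/rH.
  by rewrite subr0 cabs_circle_node.
have -> : circle_mean h n s - h 0 =
   (circle_mean h n s - circle_mean h n s1)
 + (circle_mean h n s1 - circle_mean h n s0)
 - (circle_mean h n s2 - circle_mean h n s0)
 + (circle_mean h n s2 - circle_mean h n s3)
 + (circle_mean h n s3 - h 0) by ring.
move: H1 A1 A2 H2 A3.
move: (circle_mean h n s - circle_mean h n s1) => a.
move: (circle_mean h n s1 - circle_mean h n s0) => b.
move: (circle_mean h n s2 - circle_mean h n s0) => c.
move: (circle_mean h n s2 - circle_mean h n s3) => f.
move: (circle_mean h n s3 - h 0) => g *.
have := cabsD (a + b - c + f) g; have := cabsD (a + b - c) f.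
have := cabsB (a + b) c; have := cabsD a b; lra.
Qed.

End CircleMeans.

(** * Interpolation at roots of unity, and bounds for functionals on entire functions *)

Section CircleInterpolation.
Variable R : realType.
Local Notation C := (C R).
Implicit Types (h F : C -> C).

Lemma eq_near_derivable F h (z : C) (r : R) : 0 < r ->
  (forall w, cabs (w - z) < r -> F w = h w) ->
  derivable F z 1 -> derivable h z 1.
Proof.
move=> r0 Fh /derivable_cabsP[l lP]; apply/derivable_cabsP; exists l => e e0.
have [d d0 dH] := lP e e0.
exists (Num.min d r); first by rewrite lt_min d0.
move=> w; rewrite lt_min => /andP[wd wr].
by rewrite -(Fh _ wr) -(Fh z) ?subrr ?cabs0//; exact: dH.
Qed.

(* The polynomial of degree less than [2 ^ n] interpolating [F] at the nodes. *)
Definition circle_interp F n (s : R) (z : C) : C :=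
  (2 ^ n)%:R^-1 * \sum_(j < 2 ^ n)
     F (circle_node n s j) * \sum_(k < 2 ^ n) (z / circle_node n s j) ^+ k.

(** By the geometric series, the error is a factor of modulus at most [2] times the circle mean of
    [h w = w * (F w - F z) / (w - z)], and these means tend to [h 0 = 0]. *)
Lemma circle_interp_cvg F (s : R) (z : C) : entire F -> cabs z < expR s ->
  circle_interp F n s z @[n --> \oo] --> F z.
Proof.
move=> dF zs; apply/cvg_cabsP => e e0.
have /derivable_cabsP[l lP] := dF z.
(* The difference quotient, completed by the derivative at [z]: there only continuity is shown, so
   the circle through [z] is the exceptional one. *)
pose q w : C := if w == z then l else (F w - F z) / (w - z).
pose h w : C := w * q w.
have dh w : w != z -> derivable h w 1.
  move=> wz; apply: (@eq_near_derivable (fun y => y * ((F y - F z) * (y - z)^-1)) _ _ (cabs (w - z))).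
  - by rewrite cabs_gt0 subr_eq0.
  - move=> y yw; rewrite /h /q; case: eqVneq yw => // ->.
    by rewrite cabsC ltxx.
  apply: (@derivableM _ _ (fun y => y) (fun y => (F y - F z) * (y - z)^-1)).
    exact: derivable_id.
  apply: (@derivableM _ _ (fun y => F y - F z) (fun y => (y - z)^-1)).
    by apply: derivableB; [exact: dF | exact: derivable_cst].
  apply: (@derivableV _ _ (fun y => y - z)); first by rewrite subr_eq0.
  by apply: derivableB; [exact: derivable_id | exact: derivable_cst].
have cq : {for z, continuous q}.
  apply/continuous_cabsP => e1 e10.
  have [d d0 dH] := lP (e1 / 2) ltac:(by rewrite divr_gt0).
  exists d => // w wd; rewrite /q eqxx; case: eqVneq => [_|wz].
    by rewrite subrr cabs0.
  have wz0 : w - z != 0 by rewrite subr_eq0.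
  have c0 : 0 < cabs (w - z) by rewrite cabs_gt0.
  have -> : (F w - F z) / (w - z) - l = (F w - F z - l * (w - z)) / (w - z) by field.
  rewrite cabsM cabsV ltr_pdivrMr//; apply: le_lt_trans (dH _ wd) _.
  by rewrite ltr_pM2r// ltr_pdivrMr// ltr_pMr// ltr1n.
have ch : continuous h.
  move=> w; have [->|wz] := eqVneq w z; last exact/derivable_continuousC/dh.
  have hE y : h y = F y - F z + z * q y.
    rewrite /h /q; case: eqVneq => [->|yz]; first by rewrite subrr add0r.
    by field; rewrite subr_eq0.
  apply/continuous_cabsP => e1 e10.
  have Z0 : 0 < 2 * (cabs z + 1) by rewrite mulr_gt0// ltr_wpDl ?cabs_ge0.
  have [d d0 dH] := (continuous_cabsP _ _).1 cq _ (divr_gt0 e10 Z0).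
  have [d' d'0 d'H] := (continuous_cabsP _ _).1 (derivable_continuousC (dF z)) _
    (divr_gt0 e10 (ltr0n R 2)).
  exists (Num.min d d'); first by rewrite lt_min d0.
  move=> y; rewrite lt_min => /andP[/dH {}dH /d'H {}d'H].
  rewrite !hE subrr add0r -addrA -mulrBr; apply: le_lt_trans (cabsD _ _) _.
  rewrite cabsM (splitr e1) ltr_leD//; rewrite ltr_pdivlMr// in dH.
  by have := cabs_ge0 z; have := cabs_ge0 (q y - q z); nra.
(* No circle passes through [z = 0], so in that case [s - 1] is an arbitrary choice. *)
have [s0 s0s s0z] : exists2 s0, s0 < s & z = 0 \/ cabs z = expR s0.
  have [z0|z0] := eqVneq z 0; first by exists (s - 1); [rewrite gtrBl | left].
  exists (ln (cabs z)); last by right; rewrite lnK// posrE cabs_gt0.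
  by rewrite -ltr_expR lnK// posrE cabs_gt0.
have [|N NH] := circle_mean_value s0s ch _ (divr_gt0 e0 (ltr0n R 2) : 0 < e / 2).
  move=> w w0 ws; apply: dh; apply/eqP => wz; case: s0z => [z0|zE].
    by rewrite wz z0 eqxx in w0.
  by rewrite wz zE eqxx in ws.
exists N => n /NH.
have -> : h 0 = 0 by rewrite /h mul0r.
rewrite subr0 => mh.
pose r := cexp (RtoC s) ^+ (2 ^ n).
have nodez j : circle_node n s j != z.
  by apply/eqP => jz; move: zs; rewrite -jz cabs_circle_node ltxx.
(* The interpolation reproduces the constant [1], which lets [F z] be brought under the sum over the
   nodes. *)
have orth : (2 ^ n)%:R^-1 * \sum_(j < 2 ^ n) \sum_(k < 2 ^ n) (z / circle_node n s j) ^+ k = 1.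
  rewrite exchange_big/= (bigD1 (Ordinal (expn_gt0 2 n : 0 < 2 ^ n)%N))//=.
  rewrite [X in _ + X]big1 ?addr0.
    rewrite (eq_bigr (fun=> 1)); last by move=> j _; rewrite expr0.
    by rewrite sumr_const card_ord mulVf// pow2_neq0.
  move=> k k0; under eq_bigr do rewrite exprMn.
  rewrite -big_distrr/= sum_circle_nodeVX ?mulr0// ltn_ord andbT lt0n.
  by apply: contraNneq k0 => k0; apply/eqP/val_inj.
have -> : F z - circle_interp F n s z = - ((1 - z ^+ (2 ^ n) / r) * circle_mean h n s).
  rewrite -{1}[F z]mulr1 -{1}orth /circle_interp /circle_mean.
  rewrite [F z * _]mulrCA -mulrBr [_ * (_^-1 * _)]mulrCA -mulrN; congr (_ * _).
  rewrite big_distrr -sumrB big_distrr -sumrN /=; apply: eq_bigr => j _.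
  have := nodez j; have := circle_node_neq0 n s j; have := circle_nodeX n s j.
  rewrite -/r; move: (circle_node n s j) => y yr y0 yz.
  have r0 : r != 0 by rewrite -yr expf_neq0.
  have yz0 : y - z != 0 by rewrite subr_eq0.
  have x1 : z / y - 1 != 0.
    by rewrite subr_eq0; apply: contra yz => /eqP h1; rewrite -(divfK y0 z) h1 mul1r.
  have -> : \sum_(k < 2 ^ n) (z / y) ^+ k = (z ^+ (2 ^ n) / r - 1) / (z / y - 1).
    by apply: (mulfI x1); rewrite -subrX1 exprMn exprVn yr [RHS]mulrC divfK.
  move: (_ / r) => X; rewrite /h /q (negbTE yz); by field; rewrite yz0 y0 /= mulN1r subr_eq0 eq_sym.
rewrite cabsN cabsM.
have r1 : cabs (z ^+ (2 ^ n) / r) <= 1.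
  rewrite /r cabsM cabsV !cabsX cabs_cexp/= ler_pdivrMr ?exprn_gt0 ?expR_gt0//.
  by rewrite mul1r lerXn2r ?nnegrE ?cabs_ge0 ?expR_ge0// ltW.
have r2 : cabs (1 - z ^+ (2 ^ n) / r) <= 2.
  by apply: le_trans (cabsB _ _) _; rewrite cabs1; lra.
apply: le_lt_trans (ler_wpM2r (cabs_ge0 _) r2) _; lra.
Qed.

(** The closed form of the partial sums is proved by induction; [6] is the value of the full
    series. *)
Lemma sum_sqr_geom n : \sum_(k < n) (k%:R ^+ 2 / 2 ^+ k) <= 6 :> R.
Proof.
suff -> : \sum_(k < n) (k%:R ^+ 2 / 2 ^+ k)
    = 6 - 2 * (n%:R ^+ 2 + 2 * n%:R + 3) / 2 ^+ n :> R.
  have n0 : 0 <= n%:R :> R by rewrite ler0n.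
  by rewrite gerBl; apply: divr_ge0; [nra | rewrite exprn_ge0].
elim: n => [|n IH]; first by rewrite big_ord0 expr0; field.
rewrite big_ord_recr/= IH (exprS 2 n) -(natr1 n).
by field; rewrite expf_neq0.
Qed.

Lemma cvg_lincomb m (c l : 'I_m -> C) (u : nat -> 'I_m -> C) :
  (forall i, u n i @[n --> \oo] --> l i) ->
  \sum_i c i * u n i @[n --> \oo] --> \sum_i c i * l i.
Proof.
move=> ul; apply/cvg_cabsP => e e0.
pose K : R := \sum_i cabs (c i) + 1.
have K0 : 0 < K by rewrite ltr_wpDl ?sumr_ge0// => i _; rewrite cabs_ge0.
have /choice[N NH] : forall i, exists N, forall n, (N <= n)%N -> cabs (l i - u n i) < e / K.
  by move=> i; apply: (cvg_cabsP _ _).1 (ul i) _ (divr_gt0 e0 K0).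
exists (\max_i N i) => n nN.
rewrite -sumrB; apply: le_lt_trans (cabs_sum _ _ _) _.
apply: le_lt_trans (_ : (\sum_i cabs (c i)) * (e / K) < e).
  rewrite big_distrl/=; apply: ler_sum => i _.
  rewrite -mulrBr cabsM ler_wpM2l ?cabs_ge0// ltW// NH//.
  by apply: leq_trans nN; exact: leq_bigmax.
by rewrite mulrA ltr_pdivrMr// mulrC ltr_pM2l// ltrDl.
Qed.

(** The functional is known on monomials, hence on interpolation polynomials. At radius [2 * a] the
    [k]-th coefficient carries [(2 * a) ^- k], so the errors sum to [A * M] times the series of
    [k ^ 2 / 2 ^ k]. The bound does not depend on the interpolation level and passes to the
    limit. *)
Lemma interp_functional_bound F (m : nat) (c t : 'I_m -> C) (b : C) (a A s M : R) :
  entire F -> 0 < a -> 0 <= A -> expR s = 2 * a -> cabs b < 2 * a ->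
  (forall i, cabs (t i) < 2 * a) ->
  (forall n j, (j < 2 ^ n)%N -> cabs (F (circle_node n s j)) <= M) ->
  (forall k, cabs (b ^+ k - \sum_i c i * t i ^+ k) <= A * k%:R ^+ 2 * a ^+ k) ->
  cabs (F b - \sum_i c i * F (t i)) <= 6 * A * M.
Proof.
move=> dF a0 A0 sE hb ht hM hA.
have M0 : 0 <= M by apply: le_trans (hM 0%N 0%N _); rewrite ?cabs_ge0.
pose u n := circle_interp F n s b - \sum_i c i * circle_interp F n s (t i).
have uF : u n @[n --> \oo] --> F b - \sum_i c i * F (t i).
  apply: cvgB; first by apply: circle_interp_cvg => //; rewrite sE.
  by apply: cvg_lincomb => i; apply: circle_interp_cvg => //; rewrite sE.
have ub n : cabs (u n) <= 6 * A * M.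
  have -> : u n = (2 ^ n)%:R^-1 * \sum_(j < 2 ^ n) (F (circle_node n s j) *
      \sum_(k < 2 ^ n) (circle_node n s j)^-1 ^+ k * (b ^+ k - \sum_i c i * t i ^+ k)).
    rewrite /u /circle_interp.
    under [X in _ - X]eq_bigr do rewrite mulrCA.
    rewrite -big_distrr/= -mulrBr; congr (_ * _).
    under [X in _ - X]eq_bigr do rewrite big_distrr/=.
    rewrite exchange_big/= -sumrB; apply: eq_bigr => j _.
    under [X in _ - X]eq_bigr do rewrite mulrCA.
    rewrite -big_distrr/= -mulrBr; congr (_ * _).
    under [X in _ - X]eq_bigr do rewrite big_distrr/=.
    rewrite exchange_big/= -sumrB; apply: eq_bigr => k _.
    rewrite mulrBr exprMn mulrC; congr (_ - _).
    by rewrite big_distrr; apply: eq_bigr => i _ /=; rewrite exprMn; ring.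
  rewrite cabsM cabsV cabs_nat ler_pdivrMl ?ltr0n ?expn_gt0//.
  apply: le_trans (cabs_sum _ _ _) _.
  apply: le_trans (ler_sum _ (_ : forall j : 'I_(2 ^ n), true -> _ <= 6 * A * M)) _; last first.
    by rewrite sumr_const card_ord [leRHS]mulr_natl.
  move=> j _; rewrite cabsM mulrC ler_pM ?cabs_ge0//; last exact: hM.
  apply: le_trans (cabs_sum _ _ _) _.
  apply: le_trans (_ : A * \sum_(k < 2 ^ n) (k%:R ^+ 2 / 2 ^+ k) <= _); last first.
    by rewrite mulrC ler_wpM2r// sum_sqr_geom.
  rewrite big_distrr/=; apply: ler_sum => k _.
  rewrite cabsM cabsX cabsV cabs_circle_node sE.
  apply: le_trans (ler_wpM2l _ (hA k)) _.
    by rewrite exprn_ge0// invr_ge0 mulr_ge0// ltW.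
  rewrite le_eqVlt; apply/orP; left; apply/eqP.
  by rewrite exprVn exprMn; field; rewrite !expf_neq0// gt_eqF.
apply/ler_addgt0Pr => e e0.
have [N /(_ N (leqnn _)) NH] := (cvg_cabsP _ _).1 uF e e0.
have := cabsD (F b - \sum_i c i * F (t i) - u N) (u N).
rewrite subrK; have := ub N; lra.
Qed.

End CircleInterpolation.

(** * Moments of the extrapolated Bernstein operator *)

Section BernsteinMoments.
Variable R : realType.
Implicit Types (a x y : R) (f : R -> R).

(** Sum over [n]-step walks with weight [x] for a step [+1] and [y] for a step [-1]. Unscaled
    endpoints [n - 2 j] replace [1 - 2 j / n] so that a step is a shift independent of [n]. *)
Definition bern_sum x y n f : R :=
  \sum_(j < n.+1) 'C(n, j)%:R * x ^+ (n - j) * y ^+ j * f (n%:R - 2 * j%:R).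

Lemma bern_sum0 x y f : bern_sum x y 0 f = f 0.
Proof. by rewrite /bern_sum big_ord1 /= bin0 !expr0 !mulr1 mul1r mulr0 subr0. Qed.

(** Pascal's rule, that is, splitting off one step of the walk. *)
Lemma bern_sumS x y n f :
  bern_sum x y n.+1 f =
  x * bern_sum x y n (fun t => f (t + 1)) + y * bern_sum x y n (fun t => f (t - 1)).
Proof.
pose T j : R := x ^+ (n.+1 - j) * y ^+ j * f (n.+1%:R - 2 * j%:R).
have -> : bern_sum x y n.+1 f
  = \sum_(j < n.+2) 'C(n, j)%:R * T j + \sum_(j < n.+1) 'C(n, j)%:R * T j.+1.
  rewrite /bern_sum big_ord_recl [in RHS]big_ord_recl -addrA; congr (_ + _).
    by rewrite !bin0 /T/= !mulrA.
  rewrite -big_split/=; apply: eq_bigr => j _.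
  by rewrite -mulrDl -natrD /T binS !mulrA.
rewrite big_ord_recr/= bin_small// mul0r addr0 /bern_sum !big_distrr/=.
congr (_ + _); apply: eq_bigr => j _; rewrite /T.
  rewrite subSn -1?ltnS// exprS -(natr1 n).
  by rewrite (_ : n%:R + 1 - 2 * j%:R = n%:R - 2 * j%:R + 1); ring.
rewrite subSS exprS -(natr1 n) -(natr1 j).
by rewrite (_ : n%:R + 1 - 2 * (j%:R + 1) = n%:R - 2 * j%:R - 1); ring.
Qed.

Definition moment a n k : R :=
  bern_sum ((1 + a) / 2) ((1 - a) / 2) n (fun t => t ^+ k).

Lemma moment0 a k : moment a 0 k = (k == 0)%:R.
Proof. by rewrite /moment bern_sum0 expr0n. Qed.

(* The derivatives at [u = 0] of [cosh u + a * sinh u], whose [n]-th power is the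
   exponential generating function of the moments. *)
Definition step_coef a i : R := if odd i then a else 1.

(** Expanding [(t + 1) ^+ k] and [(t - 1) ^+ k] leaves the coefficients
    [(1 + a) / 2 + (-1) ^ i * (1 - a) / 2], which are [1] or [a] by parity. *)
Lemma momentS a n k :
  moment a n.+1 k = \sum_(i < k.+1) 'C(k, i)%:R * step_coef a i * moment a n (k - i).
Proof.
rewrite /moment bern_sumS /bern_sum !big_distrr/= -big_split/=.
under [RHS]eq_bigr do rewrite big_distrr/=.
rewrite exchange_big/=; apply: eq_bigr => j _.
set t := n%:R - _; rewrite !exprDn.
set p := 'C(n, j)%:R * _ * _.
under [RHS]eq_bigr do rewrite mulrCA.
rewrite -big_distrr/=.
rewrite mulrCA (mulrCA ((1 - a) / 2)) -mulrDr; congr (_ * _).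
rewrite !big_distrr -big_split/=; apply: eq_bigr => i _.
rewrite expr1n -mulr_natl -signr_odd /step_coef; case: (odd i) => /=.
  by rewrite -mulr_natl expr1; field.
by rewrite -mulr_natl expr0; field.
Qed.

(** The weight [(1 - a) / 2] is negative, but the recurrence has nonnegative coefficients. They are
    at most [a ^+ i], and the binomial theorem for [n * a + a] closes the induction. *)
Lemma moment_ge0_le a n k : 1 < a -> 0 <= moment a n k <= (n%:R * a) ^+ k.
Proof.
move=> a1; have a0 : 0 <= a by lra.
have sc0 i : 0 <= step_coef a i by rewrite /step_coef; case: ifP.
have sc1 i : step_coef a i <= a ^+ i.
  rewrite /step_coef; case: ifP => oi; last by rewrite exprn_ege1 ?ltW.
  by case: i oi => // i _; rewrite exprS ler_peMr// exprn_ege1 ?ltW.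
elim: n k => [|n IH] k.
  by rewrite moment0 mul0r expr0n lexx andbT.
rewrite momentS; apply/andP; split.
  by apply: sumr_ge0 => i _; rewrite !mulr_ge0//; case/andP: (IH (k - i)%N).
rewrite -natr1 mulrDl mul1r exprDn; apply: ler_sum => i _.
have /andP[h1 h2] := IH (k - i)%N.
rewrite -[leRHS]mulr_natl -mulrA ler_wpM2l// [leRHS]mulrC.
by apply: ler_pM.
Qed.

(** Only the terms [i = 0] and [i = 1] of the recurrence are kept; they reproduce the recurrence of
    falling factorials. *)
Lemma moment_ge a n k : 1 < a -> (n ^_ k)%:R * a ^+ k <= moment a n k.
Proof.
move=> a1; have a0 : 0 <= a by lra.
have mp n' k' : 0 <= moment a n' k' by case/andP: (moment_ge0_le n' k' a1).
have sc0 i : 0 <= step_coef a i by rewrite /step_coef; case: ifP.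
elim: n k => [|n IH] k.
  rewrite moment0; case: k => [|k]; first by rewrite ffactn0 expr0 mulr1.
  by rewrite ffact0n /= mul0r.
case: k => [|k].
  rewrite momentS big_ord1 ffactn0 expr0 mulr1 /step_coef /= ?bin0 !mul1r.
  by apply: le_trans (IH 0%N); rewrite ffactn0 expr0 mulr1.
rewrite momentS 2!big_ord_recl/= /bump/= bin0 bin1 /step_coef/= !mul1r subn0 subSS subn0.
have -> : ((n.+1 ^_ k.+1)%:R * a ^+ k.+1 : R)
  = (n ^_ k.+1)%:R * a ^+ k.+1 + k.+1%:R * a * ((n ^_ k)%:R * a ^+ k).
  rewrite (_ : n.+1 ^_ k.+1 = n ^_ k.+1 + k.+1 * n ^_ k)%N.
    by rewrite natrD natrM exprS; ring.
  rewrite ffactSS [in RHS]ffactnSr.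
  have [kn|nk] := leqP k n; first by rewrite (mulnC (n ^_ k)) -mulnDl addnS subnK.
  by rewrite ffact_small// !muln0.
apply: lerD; first exact: IH.
rewrite -[leLHS]addr0; apply: lerD.
  by rewrite ler_wpM2l// ?mulr_ge0.
by apply: sumr_ge0 => i _; rewrite !mulr_ge0 ?mp//; case: ifP.
Qed.

(** Multiplying through by [n] avoids the exponent [k - 1]. *)
Lemma ffact_ge n k : (n%:R ^+ k - (n ^_ k)%:R) * n%:R <= k%:R ^+ 2 * n%:R ^+ k :> R.
Proof.
elim: k => [|k IH]; first by rewrite ffactn0 expr0 subrr mul0r expr0n /= mul0r.
have lek : (n ^_ k)%:R <= n%:R ^+ k :> R.
  rewrite -natrX ler_nat; elim: (k) => // k' IH'.
  by rewrite ffactnSr expnSr leq_mul// leq_subr.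
(* Only an inequality, since natural subtraction is truncated when [k] exceeds [n]. *)
have sub : n%:R - k%:R <= (n - k)%:R :> R.
  by rewrite lerBlDr -natrD ler_nat; lia.
have n0 : 0 <= n%:R :> R by rewrite ler0n.
have k0 : 0 <= k%:R :> R by rewrite ler0n.
have f0 : 0 <= (n ^_ k)%:R :> R by rewrite ler0n.
have X0 : 0 <= n%:R ^+ k :> R by rewrite exprn_ge0.
rewrite ffactnSr natrM !exprSr -natr1.
move: IH lek sub n0 k0 f0 X0.
move: (n%:R : R) ((n - k)%:R : R) (k%:R : R) ((n ^_ k)%:R : R) => N D K f.
move: (N ^+ k) => X IH lek sub n0 k0 f0 X0.
have p1 : f * (N - K) <= f * D by rewrite ler_wpM2l.
have p2 : (X * N - f * D) * N <= (X * N - f * (N - K)) * N.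
  by rewrite ler_wpM2r// lerD2l lerN2.
apply: le_trans p2 _.
have p3 : (X - f) * N * N <= K ^+ 2 * X * N by rewrite ler_wpM2r.
have p4 : f * (K * N) <= X * (K * N) by rewrite ler_wpM2r// mulr_ge0.
have p5 : 0 <= X * (K * N) by rewrite !mulr_ge0.
have p6 : 0 <= X * N by rewrite mulr_ge0.
nra.
Qed.

(** The sum is [moment a n k / n ^ k], which lies between [(n ^_ k) / n ^ k * a ^ k] and [a ^ k]. *)
Lemma bernstein_moment_bound a n k : 1 < a -> (0 < n)%N ->
  `|a ^+ k - \sum_(j < n.+1) 'C(n, j)%:R * ((1 + a) / 2) ^+ (n - j)
      * ((1 - a) / 2) ^+ j * (1 - 2 * j%:R / n%:R) ^+ k|
  <= n%:R^-1 * k%:R ^+ 2 * a ^+ k.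
Proof.
move=> a1 n0; have n0R : 0 < n%:R :> R by rewrite ltr0n.
have nk0 : 0 < n%:R ^+ k :> R by rewrite exprn_gt0.
have a0 : 0 <= a ^+ k by rewrite exprn_ge0//; lra.
have -> : \sum_(j < n.+1) 'C(n, j)%:R * ((1 + a) / 2) ^+ (n - j)
      * ((1 - a) / 2) ^+ j * (1 - 2 * j%:R / n%:R) ^+ k = moment a n k / n%:R ^+ k.
  rewrite /moment /bern_sum big_distrl/=; apply: eq_bigr => j _.
  rewrite -[RHS]mulrA -exprVn -exprMn; congr (_ * _ ^+ k).
  by field; rewrite gt_eqF.
have /andP[_ h1] := moment_ge0_le n k a1; have h2 := moment_ge n k a1.
have h3 := ffact_ge n k.
rewrite ger0_norm; last first.
  by rewrite subr_ge0 ler_pdivrMr// mulrC -exprMn.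
rewrite -(ler_pM2r nk0) mulrBl divfK ?gt_eqF// -(ler_pM2r n0R).
have -> : n%:R^-1 * k%:R ^+ 2 * a ^+ k * n%:R ^+ k * n%:R
   = k%:R ^+ 2 * n%:R ^+ k * a ^+ k by field; rewrite gt_eqF.
apply: le_trans (_ : (n%:R ^+ k - (n ^_ k)%:R) * n%:R * a ^+ k <= _); last first.
  by rewrite ler_wpM2r.
rewrite [leRHS]mulrAC ler_pM2r// mulrBl mulrC lerD2l lerN2//.
Qed.

End BernsteinMoments.

(** * The Weyl operators on the Fock space *)

Section PlaneMeasure.
Variable R : realType.
Local Notation C := (C R).

(** Such a set is the countable union of the rational boxes it contains, and boxes are measurable
    for the product sigma-algebra. *)
Lemma open_box_measurable (A : set (R * R)) :
  (forall p, A p -> exists2 d : R, 0 < d &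
     forall q, `|q.1 - p.1| < d -> `|q.2 - p.2| < d -> A q) ->
  measurable A.
Proof.
move=> H.
pose box (a b r : R) : set (R * R) :=
  `](a - r), (a + r)[%classic `*` `](b - r), (b + r)[%classic.
have boxP a b r q : box a b r q <-> `|q.1 - a| < r /\ `|q.2 - b| < r.
  by rewrite /box /= !in_itv /= -!ltr_distl.
pose B (a b r : rat) : set (R * R) :=
  if `[< box (ratr a) (ratr b) (ratr r) `<=` A >]
  then box (ratr a) (ratr b) (ratr r) else set0.
have -> : A = \bigcup_a \bigcup_b \bigcup_r B a b r.
  apply/seteqP; split => [p Ap|p [a _ [b _ [r _]]]]; last first.
    by rewrite /B; case: asboolP => // sub /sub.
  have [d d0 dH] := H p Ap.
  have [|r /[!in_itv]/= /andP[r0 rd]] := @rat_in_itvoo R 0 (d / 2).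
    by rewrite divr_gt0.
  have [|a /[!in_itv]/= a1] := @rat_in_itvoo R (p.1 - ratr r) (p.1 + ratr r).
    lra.
  have [|b /[!in_itv]/= b1] := @rat_in_itvoo R (p.2 - ratr r) (p.2 + ratr r).
    lra.
  move: a1 b1; rewrite -!ltr_distl => a1 b1.
  exists a => //; exists b => //; exists r => //; rewrite /B asboolT.
    by apply/boxP; rewrite distrC a1 distrC b1.
  move=> q /boxP[q1 q2]; apply: dH.
    by have := ler_distD (ratr a) q.1 p.1; lra.
  by have := ler_distD (ratr b) q.2 p.2; lra.
do 3 (apply: bigcupT_measurable_rat => ?).
rewrite /B; case: ifP => _; last exact: measurable0.
by apply: measurableX; exact: measurable_itv.
Qed.

Lemma measurable_box_continuous (k : R * R -> R) :
  (forall p (e : R), 0 < e -> exists2 d : R, 0 < d &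
     forall q, `|q.1 - p.1| < d -> `|q.2 - p.2| < d -> `|k q - k p| < e) ->
  measurable_fun [set: R * R] k.
Proof.
move=> H; apply: (measurability _ (RGenOpens.measurableE R)).
move=> _ [_ [a [b ->] <-]]; rewrite setTI; apply: open_box_measurable => p /=.
rewrite in_itv /= => /andP[ap pb].
have [|d d0 dH] := H p (Num.min (k p - a) (b - k p)).
  by rewrite lt_min !subr_gt0 ap.
exists d => // q q1 q2; have := dH q q1 q2; rewrite in_itv /= lt_min => /andP[].
rewrite !ltr_norml => /andP[h1 h2] /andP[h3 h4]; apply/andP; split; lra.
Qed.

(** Uniqueness of Lebesgue measure: the translated measure agrees with it on half-open intervals. *)
Lemma lebesgue_measure_shift (s : R) (A : set R) : measurable A ->
  pushforward (@lebesgue_measure R) (fun y : R => (y + s : measurableTypeR R)) A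
  = lebesgue_measure A.
Proof.
move=> mA.
have ms : measurable_fun [set: R] (fun y : R => (y + s : measurableTypeR R)).
  by apply: measurable_funD => //; exact: measurable_id.
apply/esym/lebesgue_measure_unique => //= _ [[a b]] _ <-.
rewrite /pushforward.
have -> : (fun y : R => y + s) @^-1` `]a, b] = `]a - s, b - s]%classic.
  by apply/seteqP; split => y /=; rewrite !in_itv/= ltrBlDr lerBrDr.
rewrite !lebesgue_measure_itv/= !lte_fin ltrD2r.
by case: ifP => // _; rewrite -!EFinB; congr (_%:E); ring.
Qed.

Lemma ge0_integral_shift (s : R) (k : R -> \bar R) :
  measurable_fun [set: R] k -> (forall y, (0 <= k y)%E) ->
  (\int[@lebesgue_measure R]_y k (y + s)%R = \int[@lebesgue_measure R]_y k y)%E.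
Proof.
move=> mk k0.
have ms : measurable_fun [set: R] (fun y : R => (y + s : measurableTypeR R)).
  by apply: measurable_funD => //; exact: measurable_id.
pose phi (y : R) : measurableTypeR R := y + s.
rewrite -[LHS]/(\int[lebesgue_measure]_(y in phi @^-1` setT) (k \o phi) y)%E.
rewrite -ge0_integral_pushforward//=.
by apply: eq_measure_integral => //= A mA _; exact: lebesgue_measure_shift.
Qed.

(** Tonelli's theorem reduces to the line. Shifts of the second coordinate suffice because the Weyl
    parameters are purely imaginary. *)
Lemma integral_shift2 (s : R) (k : R * R -> \bar R) :
  measurable_fun [set: R * R] k -> (forall p, (0 <= k p)%E) ->
  (\int[@lebesgue_measure R \x @lebesgue_measure R]_p k (p.1, (p.2 + s)%R)
   = \int[@lebesgue_measure R \x @lebesgue_measure R]_p k p)%E.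
Proof.
move=> mk k0.
have ms : measurable_fun [set: R * R] (fun p : R * R => (p.1, p.2 + s)).
  apply: measurable_fun_pair; first exact: measurable_fst.
  by apply: measurable_funD => //; exact: measurable_snd.
rewrite !fubini_tonelli1//; last exact: measurableT_comp mk ms.
apply: eq_integral => x _; rewrite /fubini_F /=.
rewrite (ge0_integral_shift s (k := fun y => k (x, y)))//.
exact: measurableT_comp mk (pair1_measurable x).
Qed.

End PlaneMeasure.

(** * Weyl operators with imaginary parameter as isometries with inverses *)

Section WeylOperators.
Variable R : realType.
Local Notation C := (C R).
Implicit Types (f g : C -> C) (c z : C).

Definition fock_density f (p : R * R) : R :=
  pi^-1 * ((complex.Re (f (Complex p.1 p.2))) ^+ 2
           + (complex.Im (f (Complex p.1 p.2))) ^+ 2)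
  * expR (- (p.1 ^+ 2 + p.2 ^+ 2)).

Lemma fock_density_ge0 f p : 0 <= fock_density f p.
Proof.
by rewrite /fock_density !mulr_ge0 ?expR_ge0 ?invr_ge0 ?pi_ge0 ?addr_ge0 ?sqr_ge0.
Qed.

Lemma measurable_fock_density f : entire f ->
  measurable_fun [set: R * R] (fock_density f).
Proof.
move=> df.
have cf (p : R * R) (e : R) : 0 < e -> exists2 d : R, 0 < d &
     forall q : R * R, `|q.1 - p.1| < d -> `|q.2 - p.2| < d ->
     cabs (f (Complex q.1 q.2) - f (Complex p.1 p.2)) < e.
  move=> e0; have [d d0 dH] := (continuous_cabsP _ _).1
    (derivable_continuousC (df (Complex p.1 p.2))) e e0.
  exists (d / 2); first by rewrite divr_gt0.
  move=> q q1 q2; apply: dH; apply: le_lt_trans (cabs_le_ReIm _) _ => /=.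
  by rewrite (splitr d) ltrD.
have mRe : measurable_fun [set: R * R] (fun p => complex.Re (f (Complex p.1 p.2))).
  apply: measurable_box_continuous => p e /(cf p)[d d0 dH]; exists d => // q q1 q2.
  apply: le_lt_trans (dH q q1 q2); apply: le_trans (cabs_Re _).
  by case: (f _) => ? ?; case: (f _).
have mIm : measurable_fun [set: R * R] (fun p => complex.Im (f (Complex p.1 p.2))).
  apply: measurable_box_continuous => p e /(cf p)[d d0 dH]; exists d => // q q1 q2.
  apply: le_lt_trans (dH q q1 q2); apply: le_trans (cabs_Im _).
  by case: (f _) => ? ?; case: (f _).
apply: measurable_funM.
  apply: measurable_funM => //.
  by apply: measurable_funD; apply: measurable_funX.
apply: measurableT_comp; first exact: measurable_expR.
apply: measurableT_comp; first exact: oppr_measurable.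
apply: measurable_funD; apply: measurable_funX.
  exact: measurable_fst.
exact: measurable_snd.
Qed.

Lemma conjE c : c^* = Complex (complex.Re c) (- complex.Im c) :> C.
Proof. by case: c. Qed.

Lemma derivable_affine (d k z : C) : derivable (fun w : C => w * d + k) z 1.
Proof.
apply/derivable_cabsP; exists d => e e0; exists 1 => // w _.
have -> : w * d + k - (z * d + k) - d * (w - z) = 0 by ring.
by rewrite cabs0 mulr_ge0 ?cabs_ge0// ltW.
Qed.

Lemma entire_weyl c f : entire f -> entire (weyl c f).
Proof.
move=> df z; rewrite /weyl; move: c^* (RtoC _) => d k.
apply: (@derivableM _ _ (fun z : C => f (z - c)) (fun z : C => cexp (z * d - k))).
  apply: (@derivable_compC _ f (fun z : C => z - c)); last exact: df.
  by apply: derivableB; [exact: derivable_id | exact: derivable_cst].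
apply: (@derivable_compC _ (@cexp R) (fun z : C => z * d - k)).
  exact: derivable_affine.
exact: derivable_cexp.
Qed.

(** The exponents [z * c^* - |c|^2 / 2] and [- (z - c) * c^* - |c|^2 / 2] add up to zero. *)
Lemma weylK c f z : weyl c (weyl (- c) f) z = f z.
Proof.
rewrite /weyl opprK subrK -[in RHS](mulr1 (f z)) -mulrA; congr (_ * _).
rewrite -cexpD -cexp0; congr cexp; rewrite !conjE.
case: c z => a b [x y]; apply/eqP; rewrite eq_complex /=.
by apply/andP; split; apply/eqP; field.
Qed.

(** Completing the square: the squared modulus of the Weyl factor turns the weight [exp (- |z|^2)]
    into [exp (- |z - c|^2)] with [c = iR t]. *)
Lemma fock_density_weyl (t : R) f (p : R * R) :
  fock_density (weyl (iR t) f) p = fock_density f (p.1, p.2 - t).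
Proof.
case: p => x y; rewrite /fock_density /= -!sqr_cabs /weyl.
rewrite cabsM cabs_cexp exprMn.
have -> : (Complex x y - iR t : C) = Complex x (y - t).
  by apply/eqP; rewrite eq_complex /= subr0 !eqxx.
rewrite -!mulrA; congr (_ * (_ * (_ * _))).
rewrite -!expRD; congr expR; rewrite conjE /=.
by field.
Qed.

Lemma fock_weyl (t : R) f : fock f -> fock (weyl (iR t) f).
Proof.
move=> [df nf]; split; first exact: entire_weyl.
have -> : fock_norm2 (weyl (iR t) f) = fock_norm2 f; last by [].
have := integral_shift2 (- t) (k := EFin \o fock_density f) _ _.
rewrite /fock_norm2 => <-.
- by apply: eq_integral => p _ /=; rewrite -/(fock_density _ _) fock_density_weyl.
- by apply/measurable_EFinP; exact: measurable_fock_density.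
- by move=> p; rewrite lee_fin fock_density_ge0.
Qed.

End WeylOperators.

(** * Convergence of Bernstein polynomials of entire functions outside the interval *)

Section BernsteinExtrapolation.
Variable R : realType.
Local Notation C := (C R).
Implicit Types (F f g : C -> C).

Theorem bernstein_entire F (a : R) : entire F -> 1 < a ->
  \sum_(j < n.+1) Cj n j a * F (RtoC (1 - 2 * j%:R / n%:R)) @[n --> \oo] -->
  F (RtoC a).
Proof.
move=> dF a1; have a0 : 0 < a by lra.
have a20 : 0 < 2 * a by lra.
pose s := ln (2 * a).
have sE : expR s = 2 * a by rewrite lnK// posrE.
have [M hM] := circle_bounded (h := F) (s := s)
  (fun z _ => derivable_continuousC (dF z)).
have M0 : 0 <= M.
  by apply: le_trans (cabs_ge0 _) (hM 0 _); rewrite lexx ler01.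
(* The functional bound with [A = n^-1]: the radius [2 * a] exceeds both [a] and the nodes in
   [[-1, 1]], and [M] bounds [F] on that circle for every interpolation level. *)
have bnd n : (0 < n)%N -> cabs (F (RtoC a) -
    \sum_(j < n.+1) Cj n j a * F (RtoC (1 - 2 * j%:R / n%:R))) <= 6 * n%:R^-1 * M.
  move=> n0; have n0R : 0 < n%:R :> R by rewrite ltr0n.
  apply: (interp_functional_bound (a := a) (s := s)) => //.
  - by rewrite cabs_RtoC gtr0_norm//; lra.
  - move=> j; rewrite cabs_RtoC ltr_norml; have : 0 <= (j%:R / n%:R : R) <= 1.
      by rewrite divr_ge0//= ler_pdivrMr// mul1r ler_nat -ltnS.
    by rewrite -[2 * j%:R / _]mulrA => /andP[? ?]; apply/andP; split; lra.
  - move=> m j jm; have := hM (j%:R / (2 ^ m)%:R).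
    rewrite RtoCM RtoCV !RtoC_nat; apply.
    by rewrite divr_ge0//= ler_pdivrMr ?ltr0n ?expn_gt0// mul1r ler_nat ltnW.
  - move=> k; have := bernstein_moment_bound k a1 n0; rewrite -cabs_RtoC.
    rewrite RtoCB RtoCX RtoC_sum.
    by under eq_bigr do rewrite [in RtoC _]RtoCM RtoCX.
apply/cvg_cabsP => e e0.
have K0 : 0 <= 6 * M / e by rewrite !mulr_ge0// invr_ge0 ltW.
exists (Num.bound (6 * M / e)).+1 => n nN.
have n0 : (0 < n)%N by apply: leq_trans nN.
have n0R : 0 < n%:R :> R by rewrite ltr0n.
apply: le_lt_trans (bnd n n0) _.
rewrite mulrAC ltr_pdivrMr// -ltr_pdivrMl// mulrC.
apply: lt_le_trans (archi_boundP K0) _.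
by rewrite ler_nat ltnW.
Qed.

End BernsteinExtrapolation.

(** * Identification of the limit operator *)

Section WeylLimit.
Variable R : realType.
Local Notation C := (C R).
Implicit Types (f g : C -> C).

Lemma bjE n j : bj R n j = iR (- ((1 - 2 * j%:R / n%:R) / Num.sqrt 2)).
Proof.
rewrite /bj -complexiE; set t := 1 - _.
rewrite -[LHS]/(- ((iR 1 : C) / RtoC (Num.sqrt 2)) * RtoC t).
have -> : (iR 1 : C) / RtoC (Num.sqrt 2) = iR (Num.sqrt 2)^-1.
  by rewrite -RtoCV mulrC iRM mulr1.
by rewrite mulNr mulrC iRM iRN.
Qed.

Lemma weyl_cvg f (a : R) : entire f -> 1 < a ->
  weyl_limit_repr a f (weyl (iR (- (a / Num.sqrt 2))) f).
Proof.
move=> df a1 z.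
pose b : C := iR (Num.sqrt 2)^-1.
(* For real [t] and [c = - t * b], one has [c^* = t * b] and [|c|^2 / 2 = t ^ 2 / 4]. Writing the
   conjugate as [t * b] makes the expression holomorphic in complex [t]. *)
pose F (t : C) : C := f (t * b + z) * cexp (t * (t * (- (4^-1)) + z * b)).
have FE (t : R) : weyl (iR (- (t / Num.sqrt 2))) f z = F (RtoC t).
  have tb : iR (t / Num.sqrt 2) = RtoC t * b by rewrite /b iRM.
  rewrite /weyl /F; congr (f _ * cexp _).
    by rewrite iRN opprK addrC tb.
  rewrite conjE /= opprK -/(iR _) tb expr0n/= add0r sqrrN exprMn exprVn sqr_sqrtr//.
  have -> : t ^+ 2 / 2 / 2 = t * t / 4 by field.
  rewrite !RtoCM RtoCV RtoC_nat; ring.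
have dF : entire F.
  move=> t; apply: (@derivableM _ _ (fun t : C => f (t * b + z))
     (fun t : C => cexp (t * (t * (- (4^-1)) + z * b)))).
    apply: (@derivable_compC _ f (fun t : C => t * b + z)); last exact: df.
    exact: derivable_affine.
  apply: (@derivable_compC _ (@cexp R) (fun t : C => t * (t * (- (4^-1)) + z * b))).
    apply: (@derivableM _ _ (fun t : C => t) (fun t : C => t * (- (4^-1)) + z * b)).
      exact: derivable_id.
    exact: derivable_affine.
  exact: derivable_cexp.
have := bernstein_entire dF a1; rewrite -FE.
have -> // : (fun n => \sum_(j < n.+1) Cj n j a * F (RtoC (1 - 2 * j%:R / n%:R)))
  = (fun n => \sum_(j < n.+1) Cj n j a * weyl (bj R n j) f z).
by apply/funext => n; apply: eq_bigr => j _; rewrite bjE FE.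
Qed.

Lemma weyl_limit_unique f g (a : R) : entire f -> 1 < a ->
  weyl_limit_repr a f g -> g = weyl (iR (- (a / Num.sqrt 2))) f.
Proof.
move=> df a1 fg; apply/funext => z.
exact: (cvg_unique _ (fg z) (weyl_cvg df a1 (z := z))).
Qed.

End WeylLimit.

Theorem theorem3p32 (R : realType) (a : R) (ha : 1 < a) (g : C R -> C R) (hg : fock g) :
  exists! f : C R -> C R, fock f /\ weyl_limit_repr a f g.
Proof.
pose t := a / Num.sqrt 2.
(* The limit operator is [weyl (iR (- t))], so its inverse [weyl (iR t)] supplies the witness and,
   applied to any other solution, its uniqueness. *)
have gE : weyl (iR (- t)) (weyl (iR t) g) = g.
  by apply/funext => z; have := weylK (iR (- t)) g z; rewrite -iRN opprK.
exists (weyl (iR t) g); split.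
  split; first exact: fock_weyl.
  have [df _] := fock_weyl t hg.
  by have := weyl_cvg df ha; rewrite -/t gE.
move=> f [[df _] fg]; apply/funext => z.
by rewrite (weyl_limit_unique df ha fg) -/t iRN weylK.
Qed.
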